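(* (1) Let $J_{\lambda_i}(2n_{i1},\dots,2n_{is_i})$, $i=1,\dots,p$, be Jordan tuples of which at most one has multiple maxima (i.e. $n_{i1}=n_{i2}$ for at most one $i$). Then there is a finite-dimensional complex Lie algebra whose Jordan–Kronecker invariants are these Jordan tuples together with exactly one Kronecker block, of size $1\times1$. (2) Let $q\ge2$. For any collection of Jordan tuples $J_{\lambda_i}(2n_{i1},\dots,2n_{is_i})$, $i=1,\dots,p$, there is a finite-dimensional complex Lie algebra whose Jordan–Kronecker invariants are these Jordan tuples together with exactly $q$ Kronecker blocks, all of size $1\times1$.
   Context: For a finite-dimensional complex Lie algebra $\mathfrak g$ and $x\in\mathfrak g^*$, let $\mathcal A_x$ be the skew form $(\xi,\eta)\mapsto\langle x,[\xi,\eta]\rangle$. By the Jordan–Kronecker theorem, a pair of skew forms on a finite-dimensional complex vector space admits a basis in which both are block-diagonal with Jordan $2n\times2n$ blocks with eigenvalues $\mu\in\mathbb C\cup\{\infty\}$ ($A_i=\begin{pmatrix}0&J_\mu\\-J_\mu^T&0\end{pmatrix}$, $B_i=\begin{pmatrix}0&I_n\\-I_n&0\end{pmatrix}$) and Kronecker $(2k-1)\times(2k-1)$ blocks ($k\ge1$; the $1\times1$ Kronecker block is the pair of zero $1\times1$ matrices); block data grouped by eigenvalue are unique. The JK invariants of $\mathfrak g$ are the Kronecker sizes and Jordan tuples $J_{\lambda_i}(2n_{i1},\dots,2n_{is_i})$, $n_{i1}\ge\dots\ge n_{is_i}\ge1$ (sizes of Jordan blocks with common eigenvalue $\lambda_i$;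 distinct eigenvalues regarded as distinct formal symbols) of $(\mathcal A_x,\mathcal A_a)$ for $(x,a)$ in a nonempty Zariski open subset of $\mathfrak g^*\times\mathfrak g^*$ where they are constant. A Jordan tuple has multiple maxima if $s_i\ge2$ and $n_{i1}=n_{i2}$. *)

(* Defs.v *)
From HB Require Import structures.
From mathcomp Require Import all_boot all_order all_algebra.
From mathcomp Require Import Rstruct.
From mathcomp Require Import complex.
From mathcomp Require mpoly.

Set Implicit Arguments.
Unset Strict Implicit.
Unset Printing Implicit Defensive.

Import GRing.Theory Num.Theory.
Local Open Scope ring_scope.

Definition C : closedFieldType := complex Rdefinitions.R.

(** A finite-dimensional complex Lie algebra of dimension [d], given by its
    structure constants in a basis e_0..e_{d-1}:
    [e_i, e_j] = \sum_k c i j k e_k. *)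
Definition lie_structure (d : nat) (c : 'I_d -> 'I_d -> 'I_d -> C) : Prop :=
  (forall i j k, c i j k = - c j i k) /\
  (forall i j l m,
     \sum_(k < d) (c i j k * c k l m + c j l k * c k i m + c l i k * c k j m)
     = 0).

(** For x in g^* (coordinates in the dual basis), the Gram matrix of the
    skew form A_x(xi, eta) = <x, [xi, eta]>:  (A_x)_{ij} = <x,[e_i,e_j]>. *)
Definition coadj_form (d : nat) (c : 'I_d -> 'I_d -> 'I_d -> C)
  (x : 'I_d -> C) : 'M[C]_d :=
  \matrix_(i, j) \sum_(k < d) x k * c i j k.

(** Jordan--Kronecker blocks.
    [Kron k] (k >= 1) is the Kronecker block of size (2k-1) x (2k-1);
    [Jord mu n] is the Jordan block of size 2n x 2n with eigenvalue mu,
    where [None] stands for the eigenvalue infinity. *)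
Inductive jk_block := Kron of nat | Jord of option C & nat.

Definition block_size (b : jk_block) : nat :=
  match b with Kron k => (2 * k).-1 | Jord _ n => (2 * n)%N end.

(** Skew matrix [[0, K], [-K^T, 0]] where the upper-left zero block is m x m;
    entries indexed by nat. *)
Definition skewpair (m : nat) (K : nat -> nat -> C) (i j : nat) : C :=
  if ((i < m) && (m <= j))%N then K i (j - m)%N
  else if ((m <= i) && (j < m))%N then - K j (i - m)%N
  else 0.

Definition id_entry (a b : nat) : C := (a == b)%:R.
Definition jordan_entry (mu : C) (a b : nat) : C :=
  if a == b then mu else if b == a.+1 then 1 else 0.

Definition blockA (b : jk_block) : nat -> nat -> C :=
  match b with
  | Kron k => skewpair k (fun a b => (a == b)%:R)
  | Jord (Some mu) n => skewpair n (jordan_entry mu)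
  | Jord None n => skewpair n id_entry
  end.

Definition blockB (b : jk_block) : nat -> nat -> C :=
  match b with
  | Kron k => skewpair k (fun a b => (a == b.+1)%:R)
  | Jord (Some mu) n => skewpair n id_entry
  | Jord None n => skewpair n (jordan_entry 0)
  end.

Fixpoint bdiag (f : jk_block -> nat -> nat -> C) (L : seq jk_block)
  (i j : nat) : C :=
  match L with
  | [::] => 0
  | b :: L' =>
      let s := block_size b in
      if ((i < s) && (j < s))%N then f b i j
      else if ((s <= i) && (s <= j))%N then bdiag f L' (i - s)%N (j - s)%N
      else 0
  end.

Definition jk_normal_form (n : nat) (A B : 'M[C]_n) (L : seq jk_block) : Prop :=
  sumn (map block_size L) = n /\
  exists P : 'M[C]_n,
    P \in unitmx /\
    P^T *m A *m P = \matrix_(i < n, j < n) bdiag blockA L i j /\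
    P^T *m B *m P = \matrix_(i < n, j < n) bdiag blockB L i j.

(** A Jordan tuple J(2n_1,...,2n_s): s >= 1, n_1 >= ... >= n_s >= 1
    (the tuple is stored as [:: n_1; ...; n_s]). *)
Definition jordan_tuple (t : seq nat) : bool :=
  [&& (0 < size t)%N, sorted geq t & all (fun n => (0 < n)%N) t].

Definition multiple_maxima (t : seq nat) : bool :=
  ((1 < size t)%N) && (nth 0%N t 0 == nth 0%N t 1).

Definition has_jk_type (n : nat) (A B : 'M[C]_n) (kron : seq nat)
  (tuples : seq (seq nat)) : Prop :=
  exists mus : seq (option C),
    size mus = size tuples /\ uniq mus /\
    jk_normal_form A B
      ([seq Kron k | k <- kron] ++
       flatten (map (fun p => [seq Jord p.1 m | m <- p.2]) (zip mus tuples))).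

Definition zariski_open (m : nat) (U : ('I_m -> C) -> Prop) : Prop :=
  exists fs : seq (mpoly.mpoly m C),
    forall v, U v <-> has (fun f => mpoly.meval v f != 0) fs.

(** The JK invariants of the Lie algebra (d, c) are (kron, tuples): they are
    the JK invariants of (A_x, A_a) for all (x, a) in a nonempty Zariski open
    subset of g^* x g^* = C^(d+d). *)
Definition lie_JK_invariants (d : nat) (c : 'I_d -> 'I_d -> 'I_d -> C)
  (kron : seq nat) (tuples : seq (seq nat)) : Prop :=
  exists U : ('I_(d + d) -> C) -> Prop,
    zariski_open U /\ (exists v, U v) /\
    forall v, U v ->
      has_jk_type (coadj_form c (fun j => v (lshift d j)))
                  (coadj_form c (fun j => v (rshift d j))) kron tuples.

(* Main.v *)
Require Import Defs.
From HB Require Import structures.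
From mathcomp Require Import all_boot all_order all_algebra.
From mathcomp Require Import fingroup perm zify ring.
From mathcomp Require Import Rstruct complex mpoly.

(** Let r_1, .., r_m act by commuting operators on a space M with a basis of m
    vectors f_j and q central vectors z_k: the resulting metabelian algebra has
    A_x = [[0, K_x, 0], [- K_x^T, 0, 0], [0, 0, 0]], so that everything reduces
    to the linear matrix pencil (K_x, K_a). Letting r_k f_j = f_(j-k-1) with
    f_(-1) a fixed central vector w makes K_x upper triangular Toeplitz: one
    Jordan block with eigenvalue w(x) / w(a). Amalgamating such algebras along
    the centre puts any collection of blocks together; with q >= 2 the centre
    has enough vectors w for all eigenvalues, and with q = 1 one tuple is
    obtained in this way. For a tuple with n_1 > n_2, start from
    (n_1 - 1, n_2, ..) with q = 1 and let one more row act on M as the identity: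
    this absorbs the centre and prolongs the first chain by one vector. *)

Set Implicit Arguments.
Unset Strict Implicit.
Unset Printing Implicit Defensive.

Import GRing.Theory.
Local Open Scope ring_scope.

(** * Bipartite reordering of Jordan blocks *)

(** Characteristic zero supplies infinitely many scalars: it feeds [exists_nonroot] and separates
    the eigenvalues when q >= 2. *)
Lemma C_natr_eq0 (n : nat) : (n%:R == 0 :> C) = (n == 0)%N.
Proof. exact: (@Num.Theory.pnatr_eq0 (complex.complex Rdefinitions.R)). Qed.

Local Opaque C.

Notation jsize L := (sumn [seq p.2 | p <- L]).

(** With Jordan or identity entries for [g], this is the upper right quadrant of A or of B once the
    first halves of all Jordan blocks precede the second halves. *)
Fixpoint jdiag (g : C -> nat -> nat -> C) (L : seq (C * nat)) (i j : nat) : C :=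
  match L with
  | [::] => 0
  | p :: L' =>
      if ((i < p.2) && (j < p.2))%N then g p.1 i j
      else if ((p.2 <= i) && (p.2 <= j))%N
           then jdiag g L' (i - p.2)%N (j - p.2)%N
      else 0
  end.

Lemma skewpair_ul (m : nat) (K : nat -> nat -> C) (i j : nat) :
  (i < m)%N -> (j < m)%N -> skewpair m K i j = 0.
Proof. by move=> Hi Hj; rewrite /skewpair Hi Hj (leqNgt m i) (leqNgt m j) Hi Hj. Qed.

Lemma skewpair_ur (m : nat) (K : nat -> nat -> C) (i j : nat) :
  (i < m)%N -> skewpair m K i (m + j) = K i j.
Proof. by move=> Hi; rewrite /skewpair Hi leq_addr addKn. Qed.

Lemma skewpair_dl (m : nat) (K : nat -> nat -> C) (i j : nat) :
  (j < m)%N -> skewpair m K (m + i) j = - K j i.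
Proof.
by move=> Hj; rewrite /skewpair Hj leq_addr addKn ltnNge leq_addr.
Qed.

Lemma skewpair_dr (m : nat) (K : nat -> nat -> C) (i j : nat) :
  skewpair m K (m + i) (m + j) = 0.
Proof. by rewrite /skewpair !leq_addr !ltnNge !leq_addr. Qed.

Lemma jdiag_out (g : C -> nat -> nat -> C) (L : seq (C * nat)) (i j : nat) :
  (jsize L <= i)%N || (jsize L <= j)%N -> jdiag g L i j = 0.
Proof.
elim: L i j => [//|[mu n] L IH] i j /= Hij.
case: ifP => [Hn|_]; first by exfalso; lia.
by case: ifP => // Hn; apply: IH; lia.
Qed.

Lemma jdiag_cat (g : C -> nat -> nat -> C) (L1 L2 : seq (C * nat)) (i j : nat) :
  jdiag g (L1 ++ L2) i j =
  if ((i < jsize L1) && (j < jsize L1))%N then jdiag g L1 i j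
  else if ((jsize L1 <= i) && (jsize L1 <= j))%N
       then jdiag g L2 (i - jsize L1)%N (j - jsize L1)%N
  else 0.
Proof.
elim: L1 i j => [|[mu n] L IH] i j /=; first by rewrite !subn0.
rewrite IH; case: (boolP ((i < n) && (j < n))%N) => Hn.
  by rewrite ifT //; lia.
case: (boolP ((n <= i) && (n <= j))%N) => Hn'.
  rewrite !subnDA.
  have E (k : nat) : (n <= k -> (k - n < jsize L) = (k < n + jsize L))%N by lia.
  have E' (k : nat) : (n <= k -> (jsize L <= k - n) = (n + jsize L <= k))%N.
    by lia.
  by case/andP: Hn' => *; rewrite !E ?E'.
case: ifP => // H1.
by rewrite ifF //; lia.
Qed.

Lemma jdiag_id (L : seq (C * nat)) (i j : nat) :
  jdiag (fun _ => id_entry) L i j = ((i == j) && (i < jsize L)%N)%:R.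
Proof.
elim: L i j => [|[mu n] L IH] i j /=; first by rewrite andbF.
case: ifP => Hn; first by rewrite /id_entry; congr (_%:R); lia.
case: ifP => Hn'; first by rewrite IH; congr (_%:R); lia.
by have -> : ((i == j) && (i < n + jsize L))%N = false by lia.
Qed.

(* The position, in the bipartite form [[0, K], [- K^T, 0]] with K the direct sum
   of the Jordan blocks, of the i-th vector of the block-diagonal form. *)
Fixpoint bip (L : seq (C * nat)) (i : nat) : nat :=
  match L with
  | [::] => i
  | p :: L' =>
      if (i < p.2)%N then i
      else if (i < 2 * p.2)%N then (jsize L' + i)%N
      else let k := bip L' (i - 2 * p.2)%N in
           if (k < jsize L')%N then (p.2 + k)%N else (2 * p.2 + k)%N
  end.

Lemma bip_lt (L : seq (C * nat)) (i : nat) :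
  (i < 2 * jsize L)%N -> (bip L i < 2 * jsize L)%N.
Proof.
elim: L i => [//|[mu n] L IH] i /= Hi.
case: ifP => H1; first by lia.
case: ifP => H2; first by lia.
have := IH (i - 2 * n)%N; case: ifP; lia.
Qed.

Lemma bip_inj (L : seq (C * nat)) (i j : nat) :
  (i < 2 * jsize L)%N -> (j < 2 * jsize L)%N -> bip L i = bip L j -> i = j.
Proof.
elim: L i j => [//|[mu n] L IH] i j /= Hi Hj.
have IHij := IH (i - 2 * n)%N (j - 2 * n)%N.
have := @bip_lt L (i - 2 * n)%N; have := @bip_lt L (j - 2 * n)%N.
by do ![case: ifP => ?]; lia.
Qed.

Definition jord (p : C * nat) : jk_block := Jord (Some p.1) p.2.

(** The cases are the first and the second half of the leading block, then the first and the second
    halves of the remaining blocks. *)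
Lemma bip_cases (p : C * nat) (L : seq (C * nat)) (i : nat) :
  (i < 2 * jsize (p :: L))%N ->
  [\/ (i < p.2)%N /\ bip (p :: L) i = i,
      exists2 k, (k < p.2)%N &
        i = (p.2 + k)%N /\ bip (p :: L) i = (jsize (p :: L) + k)%N,
      exists2 k, (k < 2 * jsize L)%N & i = (2 * p.2 + k)%N /\
        ((bip L k < jsize L)%N /\ bip (p :: L) i = (p.2 + bip L k)%N) |
      exists2 k, (k < 2 * jsize L)%N & i = (2 * p.2 + k)%N /\
        exists2 l, bip L k = (jsize L + l)%N &
          bip (p :: L) i = (jsize (p :: L) + (p.2 + l))%N].
Proof.
case: p => mu n /= Hi; case: ifP => H1; first by constructor 1.
case: ifP => H2.
  by constructor 2; exists (i - n)%N; [lia | split; lia].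
case: ifP => H3.
  by constructor 3; exists (i - 2 * n)%N; [lia | split; [lia | split]].
constructor 4; exists (i - 2 * n)%N; first by lia.
split; first by lia.
by exists (bip L (i - 2 * n) - jsize L)%N; lia.
Qed.

Lemma jdiag_ul (g : C -> nat -> nat -> C) p (L : seq (C * nat)) (i j : nat) :
  (i < p.2)%N -> (j < p.2)%N -> jdiag g (p :: L) i j = g p.1 i j.
Proof. by move=> Hi Hj /=; rewrite Hi Hj. Qed.

Lemma jdiag_ur (g : C -> nat -> nat -> C) p (L : seq (C * nat)) (i j : nat) :
  (i < p.2)%N -> jdiag g (p :: L) i (p.2 + j) = 0.
Proof. by move=> Hi /=; rewrite Hi ltnNge !leq_addr leqNgt Hi. Qed.

Lemma jdiag_dl (g : C -> nat -> nat -> C) p (L : seq (C * nat)) (i j : nat) :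
  (j < p.2)%N -> jdiag g (p :: L) (p.2 + i) j = 0.
Proof. by move=> Hj /=; rewrite Hj ltnNge !leq_addr /= leqNgt Hj. Qed.

Lemma jdiag_dr (g : C -> nat -> nat -> C) p (L : seq (C * nat)) (i j : nat) :
  jdiag g (p :: L) (p.2 + i) (p.2 + j) = jdiag g L i j.
Proof. by rewrite /= !addKn !leq_addr ltnNge leq_addr. Qed.

(** One reordering must serve both forms of the pair, so [f] stands for [blockA] as well as for
    [blockB]. *)
Lemma bdiag_bip (f : jk_block -> nat -> nat -> C) (g : C -> nat -> nat -> C)
    (L : seq (C * nat)) (i j : nat) :
  (forall p, f (jord p) = skewpair p.2 (g p.1)) ->
  (i < 2 * jsize L)%N -> (j < 2 * jsize L)%N ->
  bdiag f (map jord L) i j =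
  skewpair (jsize L) (jdiag g L) (bip L i) (bip L j).
Proof.
move=> fE; elim: L i j => [//|p L IH] i j Hi Hj.
set n := p.2; set T := jsize (p :: L); have TE : T = (n + jsize L)%N by [].
have E0 k l : (k < n)%N -> bdiag f (map jord (p :: L)) k (2 * n + l) = 0.
  by move=> Hk; rewrite /= -/n !ifF //; lia.
have E1 k l : (k < n)%N -> bdiag f (map jord (p :: L)) (n + k) (2 * n + l) = 0.
  by move=> Hk; rewrite /= -/n !ifF //; lia.
have E2 k l : (k < n)%N -> bdiag f (map jord (p :: L)) (2 * n + l) k = 0.
  by move=> Hk; rewrite /= -/n !ifF //; lia.
have E3 k l : (k < n)%N -> bdiag f (map jord (p :: L)) (2 * n + l) (n + k) = 0.
  by move=> Hk; rewrite /= -/n !ifF //; lia.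
have E4 k l : (k < 2 * n)%N -> (l < 2 * n)%N ->
    bdiag f (map jord (p :: L)) k l = skewpair n (g p.1) k l.
  by move=> Hk Hl; rewrite /= -/n Hk Hl fE.
have E5 k l : (k < 2 * jsize L)%N -> (l < 2 * jsize L)%N ->
    bdiag f (map jord (p :: L)) (2 * n + k) (2 * n + l) =
    skewpair (jsize L) (jdiag g L) (bip L k) (bip L l).
  move=> Hk Hl; rewrite -IH //= -/n !addKn ifF; last by lia.
  by rewrite ifT //; lia.
have [[Hi' ->]|[k Hk [-> ->]]|[k Hk [-> [Hk' ->]]]|[k Hk [-> [k' Ek ->]]]]
   := bip_cases Hi;
have [[Hj' ->]|[l Hl [-> ->]]|[l Hl [-> [Hl' ->]]]|[l Hl [-> [l' El ->]]]]
   := bip_cases Hj; rewrite -?/n -?/T.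
- by rewrite E4 ?skewpair_ul //; lia.
- rewrite E4 ?skewpair_ur ?jdiag_ul //; lia.
- by rewrite E0 // skewpair_ul //; lia.
- by rewrite E0 // skewpair_ur ?jdiag_ur //; lia.
- rewrite E4 ?skewpair_dl ?jdiag_ul //; lia.
- rewrite E4 ?skewpair_dr //; lia.
- by rewrite E1 // skewpair_dl ?jdiag_dl ?jdiag_dr ?oppr0 //; lia.
- by rewrite E1 // skewpair_dr.
- by rewrite E2 // skewpair_ul //; lia.
- by rewrite E3 // skewpair_ur ?jdiag_dl //; lia.
- by rewrite E5 // !skewpair_ul //; lia.
- by rewrite E5 // El !skewpair_ur ?jdiag_dr //; lia.
- by rewrite E2 // skewpair_dl ?jdiag_ur ?oppr0 //; lia.
- by rewrite E3 // skewpair_dr.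
- by rewrite E5 // Ek !skewpair_dl ?jdiag_dr //; lia.
- by rewrite E5 // Ek El !skewpair_dr.
Qed.

(** * Skew forms built from a matrix pencil *)

Definition Jm (m : nat) (L : seq (C * nat)) : 'M[C]_m :=
  \matrix_(i, j) jdiag jordan_entry L i j.

Definition skewmx (m q : nat) (K : 'M[C]_m) : 'M[C]_(m + (m + q)) :=
  block_mx 0 (row_mx K 0) (- col_mx K^T 0) 0.

(** Rows and columns of the quadrant change independently, so congruence of skew forms becomes
    strict equivalence of pencils. *)
Lemma skewmx_congr (m q : nat) (U K V : 'M[C]_m) :
  let P := block_mx U^T 0 0 (block_mx V 0 0 1%:M) in
  P^T *m skewmx q K *m P = skewmx q (U *m K *m V).
Proof.
rewrite /= /skewmx !tr_block_mx !trmx0 trmxK trmx1 !mulmx_block.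
rewrite !(mul0mx, mulmx0, add0r, addr0) mulmxN mulNmx.
rewrite mul_mx_row mulmx0 mul_row_block !(mul0mx, mulmx0, add0r, addr0).
rewrite mul_block_col !(mul0mx, mulmx0, add0r, addr0) mul_col_mx mul0mx.
by rewrite !trmx_mul !mulmxA.
Qed.

(** The last [q] indices lie beyond the support of [jdiag g L], so [skewpair] already vanishes on
    the central rows and columns. *)
Lemma skewmx_jdiag (m q : nat) (g : C -> nat -> nat -> C) (L : seq (C * nat))
    (i j : 'I_(m + (m + q))) :
  jsize L = m ->
  skewmx q (\matrix_(i < m, j < m) jdiag g L i j) i j =
  skewpair m (jdiag g L) i j.
Proof.
move=> mE; rewrite /skewmx -(splitK i) -(splitK j).
case: (split i) => i'; case: (split j) => j' /=.
- by rewrite block_mxEul mxE skewpair_ul.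
- rewrite block_mxEur skewpair_ur // -(splitK j'); case: (split j') => k /=.
    by rewrite row_mxEl mxE.
  by rewrite row_mxEr mxE jdiag_out //; lia.
- rewrite block_mxEdl mxE skewpair_dl // -(splitK i').
  case: (split i') => k /=; first by rewrite col_mxEu !mxE.
  by rewrite col_mxEd mxE jdiag_out //; lia.
- by rewrite block_mxEdr mxE skewpair_dr.
Qed.

Lemma bdiag_kron (f : jk_block -> nat -> nat -> C) (q : nat)
    (bs : seq jk_block) (i j : nat) :
  f (Kron 1) 0%N 0%N = 0 ->
  bdiag f (nseq q (Kron 1) ++ bs) i j =
  if ((q <= i) && (q <= j))%N then bdiag f bs (i - q)%N (j - q)%N else 0.
Proof.
move=> f0; elim: q i j => [|q IH] i j; first by rewrite !subn0.
rewrite /= muln1 /=; case: i => [|i]; case: j => [|j] //=.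
  by rewrite andbF.
by rewrite IH !subn1 !subSS.
Qed.

(** The hypothesis says that (A V)^-1 X V is the Jordan matrix, while (A V)^-1 A V is the identity;
    a permutation then makes the bipartite form block-diagonal. *)
Lemma jk_normal_form_skewmx (m q : nat) (X A V : 'M[C]_m) (L : seq (C * nat)) :
  jsize L = m -> A \in unitmx -> V \in unitmx ->
  X *m V = A *m V *m Jm m L ->
  jk_normal_form (skewmx q X) (skewmx q A) (nseq q (Kron 1) ++ map jord L).
Proof.
move=> mE uA uV XV; split.
  rewrite map_cat sumn_cat map_nseq sumn_nseq -map_comp.
  suff -> : sumn (map (block_size \o jord) L) = (2 * jsize L)%N by rewrite mE /= muln1 /=; lia.
  by elim: (L) => [//|p L' IH]; rewrite /= IH; lia.
(* The 1x1 Kronecker blocks come first in the normal form but occupy the positions from 2m on in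
   [skewmx]. *)
pose f i := if (i < q)%N then (2 * m + i)%N else bip L (i - q).
have f_lt (i : 'I_(m + (m + q))) : (f i < m + (m + q))%N.
  rewrite /f; case: ifP => Hi; first by lia.
  have := @bip_lt L (i - q)%N; have := ltn_ord i; rewrite mE; lia.
pose F (i : 'I_(m + (m + q))) : 'I_(m + (m + q)) := Ordinal (f_lt i).
have F_inj : injective F.
  move=> i j /(congr1 val) /= Hij; apply: val_inj => /=.
  move: Hij; rewrite /f.
  have := @bip_lt L (i - q)%N; have := @bip_lt L (j - q)%N.
  have := @bip_inj L (i - q)%N (j - q)%N; rewrite mE.
  have := ltn_ord i; have := ltn_ord j.
  by do ![case: ifP => ?]; lia.
pose s := perm F_inj : {perm _}.
pose U := invmx (A *m V).
have uAV : A *m V \in unitmx by rewrite unitmx_mul uA.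
have UX : U *m X *m V = Jm m L by rewrite -mulmxA XV mulmxA mulVmx ?mul1mx.
have UA : U *m A *m V = \matrix_(i, j) jdiag (fun _ => id_entry) L i j.
  rewrite -mulmxA mulVmx //; apply/matrixP => i j.
  by rewrite !mxE jdiag_id mE ltn_ord andbT.
pose P0 : 'M[C]_(m + (m + q)) := block_mx U^T 0 0 (block_mx V 0 0 1%:M).
have uP0 : P0 \in unitmx.
  rewrite unitmxE /P0 !det_lblock det1 mulr1 unitrM -!unitmxE unitmx_tr uV.
  by rewrite unitmx_inv uAV.
have perm_congr (M : 'M[C]_(m + (m + q))) :
    (P0 *m perm_mx s^-1%g)^T *m M *m (P0 *m perm_mx s^-1%g)
    = \matrix_(i, j) (P0^T *m M *m P0) (s i) (s j).
  rewrite trmx_mul tr_perm_mx invgK.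
  rewrite -[LHS]/(perm_mx s *m P0^T *m M *m (P0 *m perm_mx s^-1%g)).
  rewrite !mulmxA -(mulmxA _ P0^T) -(mulmxA _ (P0^T *m M)).
  move: (P0^T *m M *m P0) => S.
  by rewrite -row_permE -col_permE; apply/matrixP => i j; rewrite !mxE.
have permP (fb : jk_block -> nat -> nat -> C) g :
    fb (Kron 1) 0%N 0%N = 0 ->
    (forall p, fb (jord p) = skewpair p.2 (g p.1)) ->
    \matrix_(i, j) skewmx q (\matrix_(i < m, j < m) jdiag g L i j) (s i) (s j)
    = \matrix_(i < m + (m + q), j < m + (m + q)) bdiag fb (nseq q (Kron 1) ++ map jord L) i j.
  move=> fb0 fbE; apply/matrixP => i j; rewrite [LHS]mxE [RHS]mxE.
  rewrite skewmx_jdiag // bdiag_kron // !permE /= /f.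
  have E k l : skewpair m (jdiag g L) (2 * m + k) l = 0.
    rewrite mul2n -addnn -addnA.
    have [Hl|Hl] := ltnP l m.
      by rewrite skewpair_dl // jdiag_out ?oppr0 //; lia.
    by rewrite -(subnKC Hl) skewpair_dr.
  have E' k l : skewpair m (jdiag g L) l (2 * m + k) = 0.
    rewrite mul2n -addnn -addnA.
    have [Hl|Hl] := ltnP l m.
      by rewrite skewpair_ur // jdiag_out //; lia.
    by rewrite -(subnKC Hl) skewpair_dr.
  have := ltn_ord i; have := ltn_ord j => Hj Hi.
  have [Hi'|Hi'] := ltnP i q; first by rewrite E.
  have [Hj'|Hj'] := ltnP j q; first by rewrite E'.
  by rewrite (bdiag_bip fbE) ?mE //; lia.
exists (P0 *m perm_mx s^-1%g); split.
  by rewrite unitmx_mul uP0 unitmx_perm.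
rewrite !perm_congr !skewmx_congr UX UA /Jm.
by split; apply: permP.
Qed.

(** * Algebras given by commuting rows *)

(** Read [M i] as left multiplication by e_i for a bilinear product. The first hypothesis kills
    every (e_i e_j) e_l, the second makes left multiplications commute; the commutator then
    satisfies the Jacobi identity. *)
Lemma lie_structure_commuting (d : nat) (M : 'I_d -> 'M[C]_d) :
  (forall i j l p, \sum_k M i j k * M k l p = 0) ->
  (forall i j, M i *m M j = M j *m M i) ->
  lie_structure (fun i j k => M i j k - M j i k).
Proof.
move=> M0 Mcomm; split=> [i j k|i j l p]; first by rewrite opprB.
(* [t a b c] is the e_p coordinate of e_a (e_b e_c), symmetric in a and b. *)
pose t a b c := \sum_k M b c k * M a k p.
have tC a b c : t a b c = t b a c.
  have := congr1 (fun S : 'M_d => S c p) (Mcomm a b).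
  by rewrite !mxE => /esym.
have E a b c : \sum_k (M a b k - M b a k) * (M k c p - M c k p)
               = t c b a - t c a b.
  transitivity (\sum_k (M a b k * M k c p - M b a k * M k c p
                 - (M a b k * M c k p - M b a k * M c k p))).
    by apply: eq_bigr => k _; ring.
  by rewrite !sumrB !M0 subrr sub0r opprB.
by rewrite !big_split /= !E (tC l j) (tC i l) (tC j i); ring.
Qed.

Lemma mulmx_block_u (R : pzRingType) (m q : nat) (A A' : 'M[R]_m)
    (B B' : 'M[R]_(m, q)) :
  (block_mx A B 0 0 : 'M_(m + q)) *m (block_mx A' B' 0 0 : 'M_(m + q))
  = block_mx (A *m A') (A *m B') 0 0.
Proof. by rewrite mulmx_block !mulmx0 !mul0mx !addr0. Qed.

Lemma mulmx_block_dr (R : pzRingType) (m n p r s t : nat)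
    (A : 'M[R]_(m, n)) (B : 'M[R]_(n, p)) :
  (block_mx 0 0 0 A : 'M_(r + m, s + n)) *m (block_mx 0 0 0 B : 'M_(s + n, t + p))
  = block_mx 0 0 0 (A *m B).
Proof. by rewrite mulmx_block !mulmx0 !mul0mx !add0r. Qed.

(** These are the two blocks of the commutation of the operators [block_mx (D i) (E i) 0 0], which
    kill the centre. *)
Definition commuting (R : pzRingType) (m q : nat) (D : 'I_m -> 'M[R]_m)
    (E : 'I_m -> 'M[R]_(m, q)) : Prop :=
  forall i j, D i *m D j = D j *m D i /\ D i *m E j = D j *m E i.

Section RowModel.

Variables m q : nat.

(* The basis is r_0 .. r_(m-1), f_0 .. f_(m-1), z_0 .. z_(q-1), and
   [r_i, f_j] = \sum_k D i j k f_k + \sum_k E i j k z_k. *)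
Definition row_act (D : 'I_m -> 'M[C]_m) (E : 'I_m -> 'M[C]_(m, q))
    (i : 'I_(m + (m + q))) : 'M[C]_(m + (m + q)) :=
  match split i with
  | inl k => block_mx 0 0 0 (block_mx (D k) (E k) 0 0)
  | inr _ => 0
  end.

Definition row_lie D E (i j k : 'I_(m + (m + q))) : C :=
  row_act D E i j k - row_act D E j i k.

Lemma row_lie_structure D E : commuting D E -> lie_structure (row_lie D E).
Proof.
move=> DE; apply: lie_structure_commuting => [i j l p|i j].
  (* Products have no component on the rows and only rows act, so (e_i e_j) e_l = 0. *)
  apply: big1 => k _; rewrite /row_act -(splitK k) unsplitK.
  case: (split k) => k' /=; last by rewrite mxE mulr0.
  case: (split i) => i'; last by rewrite mxE mul0r.
  rewrite -(splitK j); case: (split j) => j' /=.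
    by rewrite block_mxEul mxE mul0r.
  by rewrite block_mxEdl mxE mul0r.
rewrite /row_act; case: (split i) => i'; case: (split j) => j';
  rewrite ?mul0mx ?mulmx0 //.
rewrite !mulmx_block_dr !mulmx_block_u.
by have [-> ->] := DE i' j'.
Qed.

(** The value on [r_i, f_j] of a functional with coordinates [z.1] on M and [z.2] on the centre; its
    coordinates on the r_i do not occur, as no bracket has a component there. *)
Definition Kmx D E (z : 'cV[C]_m * 'cV[C]_q) : 'M[C]_m :=
  \matrix_(i, j) (D i *m z.1 + E i *m z.2 : 'cV_m) j 0.

Definition dual_coords (x : 'I_(m + (m + q)) -> C) : 'cV[C]_m * 'cV[C]_q :=
  (\col_k x (rshift m (lshift q k)), \col_k x (rshift m (rshift m k))).

Lemma coadj_form_row_lie D E (x : 'I_(m + (m + q)) -> C) :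
  coadj_form (row_lie D E) x = skewmx q (Kmx D E (dual_coords x)).
Proof.
(* [Z] is the bilinear form x(e_i e_j) of the product behind the bracket; antisymmetrizing it gives
   A_x. *)
pose Z : 'M[C]_(m + (m + q)) :=
  block_mx 0 (row_mx (Kmx D E (dual_coords x)) 0) 0 0.
have ZE i j : \sum_k x k * row_act D E i j k = Z i j.
  rewrite /row_act /Z -(splitK i) unsplitK; case: (split i) => i' /=.
    rewrite -(splitK j); case: (split j) => j' /=.
      rewrite block_mxEul mxE big_split_ord /= !big1 ?addr0 // => k _.
        by rewrite block_mxEur mxE mulr0.
      by rewrite block_mxEul mxE mulr0.
    rewrite block_mxEur big_split_ord /= big1 ?add0r => [|k _]; last first.
      by rewrite block_mxEdl mxE mulr0.
    rewrite -(splitK j'); case: (split j') => j2 /=.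
      rewrite row_mxEl big_split_ord /= [RHS]mxE [RHS]mxE; congr (_ + _);
        rewrite [RHS]mxE; apply: eq_bigr => k _; rewrite block_mxEdr.
      - by rewrite block_mxEul mulrC [in RHS]mxE.
      - by rewrite block_mxEur mulrC [in RHS]mxE.
    rewrite row_mxEr mxE big1 // => k _; rewrite block_mxEdr /block_mx.
    by rewrite col_mxEd row_mx0 mxE mulr0.
  rewrite big1 => [|k _]; last by rewrite mxE mulr0.
  by rewrite /block_mx col_mxEd row_mx0 mxE.
transitivity (Z - Z^T).
  apply/matrixP => i j; rewrite [LHS]mxE [RHS]mxE.
  rewrite [X in _ + X]mxE [X in _ - X]mxE -!ZE -sumrB.
  by apply: eq_bigr => k _; rewrite mulrBr.
rewrite /Z /skewmx tr_block_mx !trmx0 tr_row_mx trmx0.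
by rewrite opp_block_mx add_block_mx !oppr0 !addr0 add0r.
Qed.

End RowModel.

(** * Genericity *)

(** Polynomial functions without coordinates pull back directly along linear maps; they are turned
    into multivariate polynomials only at the end. *)
Inductive polyfun (V : lmodType C) : (V -> C) -> Prop :=
| polyfun_const c : polyfun (fun _ => c)
| polyfun_scalar f : scalar f -> polyfun f
| polyfun_add f g : polyfun f -> polyfun g -> polyfun (fun v => f v + g v)
| polyfun_mul f g : polyfun f -> polyfun g -> polyfun (fun v => f v * g v).

Lemma polyfun_comp (V W : lmodType C) (h : V -> W) (f : W -> C) :
  linear h -> polyfun f -> polyfun (fun v => f (h v)).
Proof.
move=> hL; elim=> [c|g gL|g k _ IHg _ IHk|g k _ IHg _ IHk].
- exact: polyfun_const.
- by apply: polyfun_scalar => a u v; rewrite hL gL.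
- exact: polyfun_add.
- exact: polyfun_mul.
Qed.

Lemma polyfun_line (V : lmodType C) (f : V -> C) (u w : V) :
  polyfun f -> exists p : {poly C}, forall t, p.[t] = f (u + t *: w).
Proof.
elim=> [c|g gL|g k _ [p pE] _ [r rE]|g k _ [p pE] _ [r rE]].
- by exists c%:P => t; rewrite hornerC.
- exists (g w *: 'X + (g u)%:P) => t.
  by rewrite hornerD hornerZ hornerX hornerC (addrC u) gL mulrC.
- by exists (p + r) => t; rewrite hornerD pE rE.
- by exists (p * r) => t; rewrite hornerM pE rE.
Qed.

Lemma exists_nonroot (p : {poly C}) : p != 0 -> exists t, p.[t] != 0.
Proof.
(* The [size p] distinct numbers 0, ..., size p - 1 are too many to be all roots. *)
move=> p0; pose s := [seq i%:R | i <- iota 0 (size p)] : seq C.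
have [/allP r|/allPn [t _ tp]] := boolP (all (root p) s); last by exists t.
have us : uniq s.
  rewrite map_inj_in_uniq ?iota_uniq // => i j _ _ /eqP.
  wlog ij : i j / (i <= j)%N => [W|].
    by case/orP: (leq_total i j) => [/W//|/W H]; rewrite eq_sym => /H.
  rewrite eq_sym -subr_eq0 -natrB // C_natr_eq0 subn_eq0 => ji.
  by apply/eqP; rewrite eqn_leq ij.
have /allP/(max_poly_roots p0) := r.
by rewrite us /s size_map size_iota ltnn => /(_ isT).
Qed.

(** Principal open sets form a base of the Zariski topology, so a single polynomial suffices. *)
Definition generic (V : lmodType C) (Q : V -> Prop) : Prop :=
  exists f v0, [/\ polyfun f, f v0 != 0 & forall v, f v != 0 -> Q v].

Lemma generic_neq0 (V : lmodType C) (f : V -> C) (v0 : V) :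
  polyfun f -> f v0 != 0 -> generic (fun v => f v != 0).
Proof. by move=> pf f0; exists f, v0. Qed.

Lemma generic_imp (V : lmodType C) (Q Q' : V -> Prop) :
  (forall v, Q v -> Q' v) -> generic Q -> generic Q'.
Proof. by move=> QQ' [f [v0 [pf f0 fQ]]]; exists f, v0; split=> // v /fQ/QQ'. Qed.

Lemma generic_true (V : lmodType C) (Q : V -> Prop) :
  (forall v, Q v) -> generic Q.
Proof.
move=> QT; exists (fun _ => 1), 0; split=> //; last by rewrite oner_eq0.
exact: polyfun_const.
Qed.

(** Irreducibility of affine space: on the line through the two witnesses both functions become
    nonzero polynomials in t, whose product has a nonroot. *)
Lemma generic_and (V : lmodType C) (Q Q' : V -> Prop) :
  generic Q -> generic Q' -> generic (fun v => Q v /\ Q' v).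
Proof.
move=> [f [u [pf fu fQ]]] [g [w [pg gw gQ]]].
have [p pE] := polyfun_line u (w - u) pf.
have [r rE] := polyfun_line u (w - u) pg.
have p0 : p != 0.
  by apply: contraNneq fu => p0; rewrite -[u]addr0 -(scale0r (w - u)) -pE p0 horner0.
have r0 : r != 0.
  apply: contraNneq gw => r0.
  by rewrite -[w](addrNK u) addrC -[w - u]scale1r -rE r0 horner0.
have [t] := exists_nonroot (mulf_neq0 p0 r0).
rewrite hornerM pE rE => fg0.
exists (fun v => f v * g v), (u + t *: (w - u)); split=> //.
  exact: polyfun_mul.
by move=> v; rewrite mulf_eq0 negb_or => /andP [/fQ ? /gQ].
Qed.

Lemma generic_all (V : lmodType C) (T : eqType) (s : seq T) (Q : T -> V -> Prop) :
  (forall x, x \in s -> generic (Q x)) ->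
  generic (fun v => forall x, x \in s -> Q x v).
Proof.
elim: s => [|x s IH] Hs; first by apply: generic_true.
have Hx : generic (Q x) by apply: Hs; rewrite mem_head.
have {}IH : generic (fun v => forall y, y \in s -> Q y v).
  by apply: IH => y ys; apply: Hs; rewrite inE ys orbT.
apply: generic_imp (generic_and Hx IH) => v [Qx Qs] y.
by rewrite inE => /predU1P [-> //|]; apply: Qs.
Qed.

Lemma generic_comp (V W : lmodType C) (h : V -> W) (g : W -> V) (Q : W -> Prop) :
  linear h -> cancel g h -> generic Q -> generic (fun v => Q (h v)).
Proof.
move=> hL gK [f [w [pf fw fQ]]]; exists (fun v => f (h v)), (g w).
by split=> [||v /fQ //]; [apply: polyfun_comp | rewrite gK].
Qed.

Lemma scalar_col (n : nat) (f : 'cV[C]_n -> C) (v : 'I_n -> C) :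
  scalar f -> f (\col_i v i) = \sum_i v i * f (delta_mx i 0).
Proof.
move=> fL; have f0 : f 0 = 0.
  by have := fL (-1) 0 0; rewrite scaler0 addr0 mulN1r addNr.
have fD : {morph f : u w / u + w}.
  by move=> u w; rewrite -{1}[u]scale1r fL mul1r.
have fZ a u : f (a *: u) = a * f u by rewrite -[a *: u]addr0 fL f0 addr0.
rewrite [\col_i v i]matrix_sum_delta (big_morph f fD f0).
by apply: eq_bigr => i _; rewrite big_ord1 fZ mxE.
Qed.

Lemma polyfun_mpoly (n : nat) (f : 'cV[C]_n -> C) :
  polyfun f -> exists p : {mpoly C[n]},
    forall v, p.@[v] = f (\col_i v i).
Proof.
elim=> [c|g gL|g k _ [p pE] _ [r rE]|g k _ [p pE] _ [r rE]].
- by exists (c%:MP_[n]) => v; rewrite mevalC.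
- exists (\sum_i (g (delta_mx i 0))%:MP_[n] * 'X_i).
  move=> v; rewrite scalar_col // raddf_sum; apply: eq_bigr => i _ /=.
  by rewrite mevalM mevalC mevalXU mulrC.
- by exists (p + r) => v; rewrite mevalD pE rE.
- by exists (p * r) => v; rewrite mevalM pE rE.
Qed.

Lemma generic_zariski_open (n : nat) (Q : 'cV[C]_n -> Prop) :
  generic Q -> exists U : ('I_n -> C) -> Prop,
    [/\ zariski_open U, exists v, U v & forall v, U v -> Q (\col_i v i)].
Proof.
move=> [f [w [/polyfun_mpoly [p pE] fw fQ]]].
exists (fun v => p.@[v] != 0); split.
- by exists [:: p] => v; rewrite /= orbF.
- exists (fun i => w i 0); rewrite pE.
  suff -> : \col_i w i 0 = w by [].
  by apply/matrixP => i j; rewrite mxE ord1.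
- by move=> v; rewrite pE => /fQ.
Qed.

(** * Jordan normal forms of pencils *)

Lemma unitmx_upper (n : nat) (A : 'M[C]_n) :
  (forall i j : 'I_n, (j < i)%N -> A i j = 0) -> (forall i, A i i != 0) ->
  A \in unitmx.
Proof.
move=> A0 Ad; rewrite unitmxE -det_tr det_trig; last first.
  by apply/is_trig_mxP => i j ij; rewrite mxE A0.
rewrite unitfE prodf_seq_neq0; apply/allP => i _; apply/implyP => _.
by rewrite mxE.
Qed.

(** This is A^-1 X = V J V^-1 without the inverses; for a Jordan matrix [J] the columns of [V] are
    Jordan chains of the pencil. *)
Definition jordan_pencil (m : nat) (X A J V : 'M[C]_m) : Prop :=
  [/\ A \in unitmx, V \in unitmx & X *m V = A *m V *m J].

Lemma jordan_entryE (mu : C) (i j : nat) :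
  jordan_entry mu i j = (i == j)%:R * mu + (j == i.+1)%:R.
Proof.
rewrite /jordan_entry; case: eqP => [->|_]; first by rewrite mul1r ltn_eqF ?addr0.
by case: ifP; rewrite mul0r add0r.
Qed.

Lemma Jm_single (m : nat) (mu : C) (i j : 'I_m) :
  Jm m [:: (mu, m)] i j = (i == j)%:R * mu + (val j == i.+1)%:R.
Proof. by rewrite mxE jdiag_ul //= jordan_entryE. Qed.

(* Relative to A, the matrix X is mu plus a strictly upper triangular Q whose
   superdiagonal has no zero, so the last basis vector is cyclic for Q. *)
Lemma jordan_pencil_upper (n : nat) (X A : 'M[C]_n.+1) (mu : C) :
  (forall i j : 'I_n.+1, (j < i)%N -> A i j = 0) -> (forall i, A i i != 0) ->
  (forall i j : 'I_n.+1, (j <= i)%N -> X i j = mu * A i j) ->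
  (forall i j : 'I_n.+1, val j = i.+1 -> X i j - mu * A i j != 0) ->
  exists V, [/\ jordan_pencil X A (Jm n.+1 [:: (mu, n.+1)]) V, V 0 0 != 0
              & forall i, i != 0 -> V i 0 = 0].
Proof.
move=> A0 Ad X0 Xd; have uA := unitmx_upper A0 Ad.
pose Z := X - mu *: A.
have [Q AQ] : exists Q, A *m Q = Z.
  by exists (invmx A *m Z); rewrite mulmxA mulmxV // mul1mx.
have ZE i j : Z i j = X i j - mu * A i j by rewrite !mxE.
have AQE i j : \sum_k A i k * Q k j = Z i j by rewrite -AQ mxE.
(* Back substitution, from the last row upwards. *)
have Q0 (i j : 'I_n.+1) : (j <= i)%N -> Q i j = 0.
  have [k ik] := ubnP (n.+1 - i); elim: k i j ik => // k IH i j ik ji.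
  have := AQE i j; rewrite ZE X0 // subrr (bigD1 i) //= big1 => [|l li].
    by rewrite addr0 => /eqP; rewrite mulf_eq0 (negPf (Ad i)) => /eqP.
  have [{}li|il] := ltnP l i; first by rewrite A0 ?mul0r.
  have {li}li : (i < l)%N by rewrite ltn_neqAle il eq_sym li.
  by rewrite IH ?mulr0 //; have := ltn_ord l; lia.
have Qd (i j : 'I_n.+1) : val j = i.+1 -> Q i j != 0.
  move=> ji; apply: contraNneq (Xd i j ji) => Qij.
  rewrite -ZE -AQE big1 // => l _.
  have [li|li] := ltnP l i; first by rewrite A0 ?mul0r.
  have [il|il] := eqVneq l i; first by rewrite il Qij mulr0.
  by rewrite Q0 ?mulr0 // ji ltn_neqAle eq_sym il.
(* The last column of Q^k vanishes below row n - k, but not in that row. *)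
have Qk k (i : 'I_n.+1) : ((n < i + k)%N -> (Q ^+ k) i ord_max = 0) /\
                 ((i + k)%N = n -> (Q ^+ k) i ord_max != 0).
  elim: k i => [|k IH] i.
    rewrite addn0 expr0 mxE; split=> [|iE]; first by have := ltn_ord i; lia.
    by rewrite (_ : i = ord_max) ?eqxx ?oner_eq0 //; apply: val_inj.
  rewrite exprS mxE; split=> ik.
    rewrite big1 // => j _; have [ji|ij] := leqP j i; first by rewrite Q0 ?mul0r.
    by rewrite (proj1 (IH j)) ?mulr0 //; lia.
  have ni : (i.+1 < n.+1)%N by lia.
  rewrite (bigD1 (Ordinal ni)) //= big1 ?addr0 => [|j ji].
    by rewrite mulf_neq0 ?Qd //; apply: (proj2 (IH (Ordinal ni))) => /=; lia.
  have [{}ji'|ij] := leqP j i; first by rewrite Q0 ?mul0r.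
  have jk : (n < j + k)%N by move: ji; rewrite -val_eqE /=; lia.
  by rewrite (proj1 (IH j)) ?mulr0.
(* Column k is Q^(n-k) e_n, so [V] is upper triangular with nonzero diagonal and its first column is
   a multiple of e_0. *)
pose V : 'M[C]_n.+1 := \matrix_(i, k) (Q ^+ (n - k)) i ord_max.
have V0 (i j : 'I_n.+1) : (j < i)%N -> V i j = 0.
  by move=> ji; rewrite mxE (proj1 (Qk _ _)) //; have := ltn_ord i; lia.
have Vd i : V i i != 0.
  by rewrite mxE (proj2 (Qk _ _)) //; have := ltn_ord i; lia.
exists V; split=> [||i i0]; [|exact: Vd|by apply: V0; rewrite lt0n].
split=> //; first exact: unitmx_upper.
have -> : X = A *m Q + mu *: A by rewrite AQ subrK.
rewrite mulmxDl -scalemxAl -!mulmxA scalemxAr -mulmxDr; congr (_ *m _).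
apply/matrixP => i k; rewrite mxE [in RHS]mxE.
under [RHS]eq_bigr do rewrite Jm_single mulrDr.
rewrite big_split /= addrC; congr (_ + _).
  rewrite (bigD1 k) //= eqxx mul1r big1 ?addr0; last first.
    by move=> j /negPf ->; rewrite mul0r mulr0.
  by rewrite mxE mulrC.
(* [Q] sends column k to column k - 1, and column 0 to Q^(n+1) e_n = 0. *)
have -> : (Q *m V) i k = (Q ^+ (n - k).+1) i ord_max.
  by rewrite exprS !mxE; apply: eq_bigr => j _; rewrite mxE.
have [k0|k0] := posnP k.
  rewrite big1 => [|j _]; last by rewrite k0 mulr0.
  by rewrite (proj1 (Qk _ _)) // k0; lia.
have kn : (k.-1 < n.+1)%N by have := ltn_ord k; lia.
rewrite (bigD1 (Ordinal kn)) //= prednK // eqxx mulr1 big1 ?addr0.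
  by rewrite mxE /=; congr ((Q ^+ _) _ _); have := ltn_ord k; lia.
move=> j jk; rewrite (_ : _ == _ = false) ?mulr0 //.
by apply: contraNF jk => /eqP jk; apply/eqP/val_inj; rewrite /= jk.
Qed.

Lemma Jm_cat (m1 m2 : nat) (L1 L2 : seq (C * nat)) :
  jsize L1 = m1 -> Jm (m1 + m2) (L1 ++ L2) = block_mx (Jm m1 L1) 0 0 (Jm m2 L2).
Proof.
move=> mE; apply/matrixP => i j; rewrite mxE jdiag_cat mE.
rewrite -(splitK i) -(splitK j).
case: (split i) => i'; case: (split j) => j' /=.
- by rewrite block_mxEul mxE !ltn_ord.
- by rewrite block_mxEur mxE !ifF //; have := ltn_ord i'; lia.
- by rewrite block_mxEdl mxE !ifF //; have := ltn_ord j'; lia.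
- by rewrite block_mxEdr mxE !leq_addr !addKn ifF //; lia.
Qed.

Lemma jordan_pencil_block (m1 m2 : nat) (X1 A1 J1 V1 : 'M[C]_m1)
    (X2 A2 J2 V2 : 'M[C]_m2) :
  jordan_pencil X1 A1 J1 V1 -> jordan_pencil X2 A2 J2 V2 ->
  jordan_pencil (block_mx X1 0 0 X2) (block_mx A1 0 0 A2) (block_mx J1 0 0 J2)
                (block_mx V1 0 0 V2).
Proof.
move=> [uA1 uV1 E1] [uA2 uV2 E2]; split.
- by rewrite unitmxE det_lblock unitrM -!unitmxE uA1.
- by rewrite unitmxE det_lblock unitrM -!unitmxE uV1.
- by rewrite !mulmx_block !mulmx0 !mul0mx !addr0 !add0r E1 E2 !mul0mx.
Qed.

(** Right multiplication by J - mu shifts a row one place to the right, so only entry 0 is missed by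
    its image. *)
Lemma row_mod_shift (k : nat) (mu : C) (h : 'rV[C]_k.+1) :
  exists f : 'rV_k.+1,
    h - h 0 0 *: delta_mx 0 0 = f *m (Jm k.+1 [:: (mu, k.+1)] - mu%:M).
Proof.
exists (\row_l (if (l < k)%N then h 0 (inord l.+1) else 0)).
apply/matrixP => i j; rewrite ord1 {i} [in RHS]mxE.
have E l : (Jm k.+1 [:: (mu, k.+1)] - mu%:M) l j = (val j == l.+1)%:R.
  by rewrite mxE Jm_single !mxE mulr_natl addrAC addrN add0r.
under [RHS]eq_bigr do rewrite E mxE.
rewrite !mxE eqxx /=; have [j0|j0] := posnP j.
  have -> : j = 0 by apply: val_inj.
  by rewrite eqxx mulr1 subrr big1 // => l _; rewrite mulr0.
have kn : (j.-1 < k.+1)%N by have := ltn_ord j; lia.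
rewrite (_ : _ == _ = false) ?mulr0 ?subr0; last by apply/negbTE; rewrite -lt0n.
rewrite (bigD1 (Ordinal kn)) //= prednK // eqxx mulr1 big1 ?addr0.
  rewrite ifT; last by have := ltn_ord j; lia.
  by congr (h 0 _); apply: val_inj; rewrite /= inordK.
move=> l lj; rewrite (_ : _ == _ = false) ?mulr0 //.
by apply: contraNF lj => /eqP lj; apply/eqP/val_inj; rewrite /= lj.
Qed.

(** For k > 0, [g] is h 0 0 times the inclusion of a chain of length k as the beginning of a chain
    of length n + 1, which intertwines the two Jordan blocks. *)
Lemma row_mod_shift_le (n k : nat) (mu : C) (h : 'rV[C]_k) :
  (k <= n.+1)%N ->
  exists (g : 'M[C]_(n.+1, k)) (f : 'rV[C]_k),
    Jm n.+1 [:: (mu, n.+1)] *m g = g *m Jm k [:: (mu, k)] /\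
    h - row 0 g = f *m (Jm k [:: (mu, k)] - mu%:M).
Proof.
case: k h => [|k] h kn.
  exists 0, 0; split; last by rewrite [RHS]thinmx0 [LHS]thinmx0.
  by rewrite mulmx0 mul0mx.
have [f fE] := row_mod_shift mu h.
pose c := h 0 0.
exists (\matrix_(p, j) (c *+ (val p == val j))), f; split.
  apply/matrixP => p j; rewrite [LHS]mxE [RHS]mxE.
  have jn : (j < n.+1)%N := leq_trans (ltn_ord j) kn.
  rewrite (bigD1 (Ordinal jn)) //= Jm_single mxE eqxx mulr1n big1 ?addr0.
    under eq_bigr do rewrite mxE Jm_single.
    have [pk|kp] := ltnP p k.+1.
      rewrite (bigD1 (Ordinal pk)) //= eqxx mulr1n big1 ?addr0 1?mulrC //.
      move=> l lp; rewrite (_ : _ == _ = false) ?mul0r //.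
      by apply: contraNF lp => /eqP lp; apply/eqP/val_inj; rewrite /= lp.
    rewrite big1 => [|l _]; last first.
      by rewrite (_ : _ == _ = false) ?mul0r //; have := ltn_ord l; lia.
    have jk := ltn_ord j.
    have -> : (p == Ordinal jn) = false by rewrite -val_eqE /=; lia.
    have -> : (val j == p.+1) = false by rewrite /=; lia.
    by rewrite mul0r addr0 mul0r.
  move=> l lj; rewrite mxE (_ : _ == _ = false) ?mulr0 //.
  by apply: contraNF lj => /eqP lj; apply/eqP/val_inj; rewrite /= lj.
rewrite -fE; congr (_ - _); apply/matrixP => i j.
rewrite !mxE ord1 eqxx /= -val_eqE /= eq_sym /c.
by case: eqP; rewrite ?mulr1n ?mulr0n ?mulr1 ?mulr0.
Qed.

(** As all blocks share [mu], the corrections for single blocks can be concatenated. *)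
Lemma row_mod_shifts (n : nat) (mu : C) (ns : seq nat) (h : 'rV[C]_(sumn ns)) :
  all (fun k => k <= n.+1)%N ns ->
  exists (g : 'M[C]_(n.+1, sumn ns)) (f : 'rV[C]_(sumn ns)),
    let J := Jm (sumn ns) [seq (mu, k) | k <- ns] in
    Jm n.+1 [:: (mu, n.+1)] *m g = g *m J /\ h - row 0 g = f *m (J - mu%:M).
Proof.
elim: ns h => [|k ns IH] h /=.
  by exists 0, 0; split; [rewrite mulmx0 mul0mx | rewrite [RHS]thinmx0 [LHS]thinmx0].
case/andP => kn {}/IH IH.
have [g2 [f2 /= [g2J f2E]]] := IH (rsubmx h).
have [g1 [f1 [g1J f1E]]] := row_mod_shift_le mu (lsubmx h) kn.
exists (row_mx g1 g2), (row_mx f1 f2).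
have -> : Jm (k + sumn ns) ((mu, k) :: [seq (mu, k0) | k0 <- ns]) =
    block_mx (Jm k [:: (mu, k)]) 0 0 (Jm (sumn ns) [seq (mu, k0) | k0 <- ns]).
  by rewrite -Jm_cat //= addn0.
split.
  by rewrite mul_mx_row mul_row_block !mulmx0 addr0 add0r g1J g2J.
rewrite scalar_mx_block opp_block_mx add_block_mx !oppr0 !addr0.
rewrite mul_row_block !mulmx0 addr0 add0r -f1E -f2E.
by rewrite row_row_mx -[h in LHS]hsubmxK opp_row_mx add_row_mx.
Qed.

(** The added vector heads the first chain: it is the new eigenvector, and J - mu sends the former
    one to it. *)
Lemma Jm_grow (n m : nat) (mu : C) (L : seq (C * nat)) :
  Jm (1 + m) ((mu, n.+2) :: L) =
  block_mx mu%:M (\row_j (val j == 0%N)%:R) 0 (Jm m ((mu, n.+1) :: L)).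
Proof.
apply/matrixP => i j; rewrite [LHS]mxE -(splitK i) -(splitK j).
case: (split i) => i'; case: (split j) => j' /=.
- by rewrite block_mxEul !ord1 !mxE.
- rewrite block_mxEur !ord1 !mxE /jordan_entry /= !add1n /= eqSS.
  by case: ifP => //; case: (val j') => //= ?; rewrite ?ltn0Sn.
- by rewrite block_mxEdl !ord1 !mxE /= !andbF; case: ifP.
- by rewrite block_mxEdr mxE.
Qed.

(** The last hypothesis is the upper right block of the required equation, once [xe = ae * mu] is
    inserted. *)
Lemma jordan_pencil_border (m : nat) (X A J V : 'M[C]_m) (x a f d : 'rV[C]_m)
    (xe ae mu c : C) :
  ae != 0 -> c != 0 -> xe = ae * mu -> jordan_pencil X A J V ->
  ae *: (f *m (J - mu%:M)) = x *m V - a *m V *m J - (ae * c) *: d ->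
  jordan_pencil (block_mx xe%:M x 0 X) (block_mx ae%:M a 0 A)
                (block_mx mu%:M d 0 J) (block_mx c%:M f 0 V : 'M_(1 + m)).
Proof.
move=> ae0 c0 xeE [uA uV XV] fE; split.
- by rewrite unitmxE det_ublock unitrM det_scalar1 -unitmxE uA unitfE ae0.
- by rewrite unitmxE det_ublock unitrM det_scalar1 -unitmxE uV unitfE c0.
rewrite !mulmx_block !mulmx0 !mul0mx !addr0 !add0r XV -!scalar_mxM.
have -> : xe * c = ae * c * mu by rewrite xeE mulrAC.
rewrite mulmxBr mul_mx_scalar scalerBr scalerA -xeE in fE.
have {}fE : ae *: (f *m J) =
    xe *: f + (x *m V - a *m V *m J - (ae * c) *: d).
  by rewrite -fE addrC subrK.
rewrite !mul_scalar_mx mulmxDl -scalemxAl fE.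
have E (p q r s : 'rV[C]_m) : s + (p + (q - r - s) + r) = p + q.
  rewrite -(addrA p) (addrAC _ _ r) subrK (addrCA s); congr (_ + _).
  by rewrite addrC subrK.
by rewrite E !mul0mx add0r.
Qed.

(* The new vector prolongs the chain of the largest block. Each further block
   is first corrected by a multiple of the image of that chain, which is what
   the assumption on [ns] makes possible. *)
Lemma jordan_pencil_grow (n : nat) (ns : seq nat)
    (X A V : 'M[C]_(n.+1 + sumn ns)) (x a : 'rV[C]_(n.+1 + sumn ns))
    (xe ae mu : C) :
  all (fun k => k <= n.+1)%N ns -> ae != 0 -> xe = ae * mu ->
  jordan_pencil X A (Jm _ [seq (mu, k) | k <- n.+1 :: ns]) V ->
  ((x - mu *: a) *m V) 0 0 != 0 ->
  exists W, jordan_pencil (block_mx xe%:M x 0 X) (block_mx ae%:M a 0 A)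
              (Jm (1 + (n.+1 + sumn ns)) [seq (mu, k) | k <- n.+2 :: ns]) W.
Proof.
move=> nsn ae0 xeE [uA uV XV] xV0.
pose J1 := Jm n.+1 [:: (mu, n.+1)].
pose J2 := Jm (sumn ns) [seq (mu, k) | k <- ns].
have JE : Jm (n.+1 + sumn ns) [seq (mu, k) | k <- n.+1 :: ns] = block_mx J1 0 0 J2.
  by rewrite -Jm_cat //= addn0.
rewrite JE in XV; set J := block_mx J1 0 0 J2 in XV.
(* Divided by [ae], the border equation reads f (J - mu) = h - c d, before the correction by [G]. *)
pose h := ae^-1 *: (x *m V - a *m V *m J).
pose c := h 0 0.
(* Column 0 of [J] is mu e_0, so x V - a V J and (x - mu a) V have the same entry 0. *)
have c0 : c != 0.
  suff E : c = ae^-1 * ((x - mu *: a) *m V) 0 0.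
    by rewrite E mulf_neq0 ?invr_eq0.
  have J00 (r : 'rV_(n.+1 + sumn ns)) : (r *m J) 0 0 = r 0 0 * mu.
    rewrite /J -JE mxE (bigD1 0) //= big1 ?addr0 => [|l l0].
      by rewrite [Jm _ _ 0 0]mxE jdiag_ul //= /jordan_entry eqxx.
    rewrite [Jm _ _ _ _]mxE /= andbT; case: ifP => _; rewrite ?andbF ?mulr0 //.
    by rewrite -val_eqE /= in l0; rewrite /jordan_entry (negPf l0) mulr0.
  have scE (k : C) (r : 'rV_(n.+1 + sumn ns)) : (k *: r) 0 0 = k * r 0 0.
    by rewrite mxE.
  have subE (r s : 'rV_(n.+1 + sumn ns)) : (r - s) 0 0 = r 0 0 - s 0 0.
    by rewrite !mxE.
  by rewrite /c /h scE subE J00 mulmxBl subE -scalemxAl scE mulrC [mu * _]mulrC mulrC.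
have [f1 f1E] := row_mod_shift mu (lsubmx h).
have [g [f2 /= [gJ f2E]]] := row_mod_shifts mu (c^-1 *: rsubmx h) nsn.
rewrite -/J1 -/J2 in gJ f2E f1E.
have hl0 : lsubmx h 0 0 = c by rewrite mxE /c; congr (h 0 _); apply: val_inj.
rewrite hl0 in f1E.
(* [G] commutes with [J], so V G may replace [V]; this turns h into h G, whose components on the
   further blocks lie in the image of J - mu. *)
pose G : 'M[C]_(n.+1 + sumn ns) := block_mx 1%:M (- g) 0 1%:M.
have uG : G \in unitmx by rewrite unitmxE det_ublock !det1 mulr1 unitr1.
have GJ : G *m J = J *m G.
  rewrite !mulmx_block !mul1mx !mulmx1 !mul0mx !mulmx0 !addr0 !add0r.
  by rewrite mulNmx mulmxN gJ.
(* On the further blocks J - mu must give h2 - h1 g, where h1 and h2 are the two parts of h; the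
   term - f1 g accounts for h1 g up to c times row 0 of g. *)
pose f := row_mx f1 (c *: f2 - f1 *m g).
pose d : 'rV[C]_(n.+1 + sumn ns) := \row_j (val j == 0%N)%:R.
have dE : d = row_mx (delta_mx 0 0) 0.
  apply/matrixP => i j; rewrite mxE -(splitK j); case: (split j) => j' /=.
    by rewrite row_mxEl mxE ord1 eqxx.
  by rewrite row_mxEr mxE.
have fE : f *m (J - mu%:M) = h *m G - c *: d.
  rewrite dE scalar_mx_block opp_block_mx add_block_mx !oppr0 !addr0.
  rewrite mul_row_block !mulmx0 addr0 add0r -f1E.
  rewrite -[h in RHS]hsubmxK mul_row_block !mulmx1 mulmx0 addr0.
  rewrite scale_row_mx opp_row_mx add_row_mx scaler0 subr0; congr row_mx.
  rewrite mulmxBl -scalemxAl -f2E scalerBr scalerA mulfV // scale1r.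
  have -> : f1 *m g *m (J2 - mu%:M) = (f1 *m (J1 - mu%:M)) *m g.
    by rewrite -!mulmxA mulmxBr mulmxBl gJ mul_scalar_mx mul_mx_scalar.
  rewrite -f1E mulmxBl -scalemxAl -rowE opprB addrA subrK mulmxN addrC.
  by [].
exists (block_mx c%:M f 0 (V *m G)).
rewrite /= Jm_grow -[Jm _ _]/(Jm _ [seq (mu, k) | k <- n.+1 :: ns]) JE -/J -/d.
have VG : jordan_pencil X A J (V *m G).
  by split; rewrite ?unitmx_mul ?uV // mulmxA XV -!mulmxA GJ.
apply: (jordan_pencil_border ae0 c0 xeE VG).
rewrite fE scalerBr scalerA scalemxAl; congr (_ - _).
by rewrite /h scalerA (mulfV ae0) scale1r mulmxBl -!mulmxA GJ.
Qed.

(** * Models with prescribed tuples *)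

Definition wval (q : nat) (w : 'rV[C]_q) (y : 'cV[C]_q) : C := (w *m y) 0 0.

Lemma wval_scalar (q : nat) (w : 'rV[C]_q) : scalar (wval w).
Proof. by move=> a u v; rewrite /wval mulmxDr -scalemxAr !mxE. Qed.

(* A pair of points of the dual, each given by its non-central coordinates and
   its central ones. *)
Notation pts m q := (('cV[C]_m * 'cV[C]_q) * ('cV[C]_m * 'cV[C]_q))%type.

(** Amalgamation along the centre: the spaces M are added, while in [sumE] both summands keep the
    same central vectors. *)
Definition sumD (R : pzRingType) (m1 m2 : nat) (D1 : 'I_m1 -> 'M[R]_m1)
    (D2 : 'I_m2 -> 'M[R]_m2) (i : 'I_(m1 + m2)) : 'M[R]_(m1 + m2) :=
  match split i with
  | inl k => block_mx (D1 k) 0 0 0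
  | inr k => block_mx 0 0 0 (D2 k)
  end.

Definition sumE (R : pzRingType) (m1 m2 q : nat) (E1 : 'I_m1 -> 'M[R]_(m1, q))
    (E2 : 'I_m2 -> 'M[R]_(m2, q)) (i : 'I_(m1 + m2)) : 'M[R]_(m1 + m2, q) :=
  match split i with
  | inl k => col_mx (E1 k) 0
  | inr k => col_mx 0 (E2 k)
  end.

Lemma commuting_sum (R : pzRingType) (m1 m2 q : nat)
    (D1 : 'I_m1 -> 'M[R]_m1) (E1 : 'I_m1 -> 'M[R]_(m1, q))
    (D2 : 'I_m2 -> 'M[R]_m2) (E2 : 'I_m2 -> 'M[R]_(m2, q)) :
  commuting D1 E1 -> commuting D2 E2 -> commuting (sumD D1 D2) (sumE E1 E2).
Proof.
move=> c1 c2 i j; rewrite /sumD /sumE.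
case: (split i) => i'; case: (split j) => j';
  rewrite !mulmx_block !mul_block_col !mulmx0 !mul0mx ?addr0 ?add0r //.
- by have [-> ->] := c1 i' j'.
- by have [-> ->] := c2 i' j'.
Qed.

Section Sum.

Variables m1 m2 q : nat.

Lemma Kmx_sum D1 E1 D2 E2 (x : 'cV[C]_(m1 + m2)) (y : 'cV[C]_q) :
  Kmx (sumD D1 D2) (sumE E1 E2) (x, y) =
  block_mx (Kmx D1 E1 (usubmx x, y)) 0 0 (Kmx D2 E2 (dsubmx x, y)).
Proof.
apply/matrixP => i j; rewrite [LHS]mxE /sumD /sumE /= -[x in LHS]vsubmxK.
rewrite -(splitK i) unsplitK; case: (split i) => i' /=;
  rewrite mul_block_col mul_col_mx add_col_mx !mul0mx ?addr0 ?add0r;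
  rewrite -(splitK j); case: (split j) => j' /=.
- by rewrite col_mxEu block_mxEul [RHS]mxE.
- by rewrite col_mxEd block_mxEur !mxE.
- by rewrite col_mxEu block_mxEdl !mxE.
- by rewrite col_mxEd block_mxEdr [RHS]mxE.
Qed.

Definition pts_u (v : pts (m1 + m2) q) : pts m1 q :=
  ((usubmx v.1.1, v.1.2), (usubmx v.2.1, v.2.2)).

Definition pts_d (v : pts (m1 + m2) q) : pts m2 q :=
  ((dsubmx v.1.1, v.1.2), (dsubmx v.2.1, v.2.2)).

Lemma generic_pts_u (Q : pts m1 q -> Prop) :
  generic Q -> generic (fun v => Q (pts_u v)).
Proof.
apply: (@generic_comp _ _ pts_u
          (fun v => ((col_mx v.1.1 0, v.1.2), (col_mx v.2.1 0, v.2.2)))).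
  by move=> a u v; rewrite /pts_u /= !linearP.
by move=> [[x y] [a b]]; rewrite /pts_u /= !col_mxKu.
Qed.

Lemma generic_pts_d (Q : pts m2 q -> Prop) :
  generic Q -> generic (fun v => Q (pts_d v)).
Proof.
apply: (@generic_comp _ _ pts_d
          (fun v => ((col_mx 0 v.1.1, v.1.2), (col_mx 0 v.2.1, v.2.2)))).
  by move=> a u v; rewrite /pts_d /= !linearP.
by move=> [[x y] [a b]]; rewrite /pts_d /= !col_mxKd.
Qed.

End Sum.

Definition ev (q : nat) (w : 'rV[C]_q) (y b : 'cV[C]_q) : C :=
  wval w y / wval w b.

(* [isotypic w ns]: a model all of whose Jordan blocks, of sizes [ns], have the
   eigenvalue attached to the central direction [w]; the last clause says that
   the eigenvector starting the first chain is not annihilated by x - mu a. *)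
Definition isotypic (q : nat) (w : 'rV[C]_q) (ns : seq nat) : Prop :=
  exists (m : nat) (D : 'I_m -> 'M[C]_m) (E : 'I_m -> 'M[C]_(m, q)),
  [/\ m = sumn ns, commuting D E &
  generic (fun v : pts m q =>
    let mu := ev w v.1.2 v.2.2 in
    wval w v.2.2 != 0 /\
    exists V, jordan_pencil (Kmx D E v.1) (Kmx D E v.2)
                (Jm m [seq (mu, n) | n <- ns]) V /\
      ((0 < head 0 ns)%N -> forall j : 'I_m, val j = 0%N ->
         ((v.1.1 - mu *: v.2.1)^T *m V) 0 j != 0))].

Lemma wval_polyfun (m q : nat) (w : 'rV[C]_q) :
  polyfun (fun v : pts m q => wval w v.2.2).
Proof. by apply: polyfun_scalar => a u v; rewrite -wval_scalar. Qed.

Lemma isotypic_nil (q : nat) (w : 'rV[C]_q) (b : 'cV[C]_q) :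
  wval w b != 0 -> isotypic w [::].
Proof.
move=> wb; exists 0%N, (fun _ => 0), (fun _ => 0); split; [by [] | by move=> [] |].
have g := @generic_neq0 _ _ ((0, 0), (0, b)) (@wval_polyfun 0 q w) wb.
apply: generic_imp g => v wv.
split=> //; exists 1%:M; split=> //.
split; rewrite ?unitmx1 //; last by rewrite [LHS]thinmx0 [RHS]thinmx0.
by rewrite unitmxE det_mx00 unitr1.
Qed.

(** This encodes r_k f_j = f_(j-k-1); [toepE] adds the boundary value f_(-1) = w, reached for j =
    k. *)
Definition toepD (n : nat) (k : 'I_n) : 'M[C]_n :=
  \matrix_(j, l) (val j == (k + l).+1)%:R.

Definition toepE (n q : nat) (w : 'rV[C]_q) (k : 'I_n) : 'M[C]_(n, q) :=
  \matrix_(j, z) ((j == k)%:R * w 0 z).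

Lemma sum_delta (n t : nat) (F : 'I_n -> C) (i0 : 'I_n) :
  val i0 = t -> \sum_(i < n) (val i == t)%:R * F i = F i0.
Proof.
move=> i0t; rewrite (bigD1 i0) //= i0t eqxx mul1r big1 ?addr0 // => i ii0.
by rewrite -i0t (inj_eq val_inj) (negPf ii0) mul0r.
Qed.

Lemma commuting_toep (n q : nat) (w : 'rV[C]_q) :
  commuting (@toepD n) (@toepE n q w).
Proof.
have S (k t : nat) (j : 'I_n) :
    \sum_(i < n) (val j == (k + i).+1)%:R * (val i == t)%:R
    = (val j == (k + t).+1)%:R :> C.
  have [tn|nt] := ltnP t n.
    by under eq_bigr do rewrite mulrC; rewrite (@sum_delta _ t _ (Ordinal tn)).
  rewrite big1 => [|i _].
    by rewrite (_ : _ == _ = false) //=; have := ltn_ord j; lia.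
  by rewrite (_ : val i == t = false) ?mulr0 //=; have := ltn_ord i; lia.
move=> k k'; split; apply/matrixP => j l; rewrite !mxE.
  under eq_bigr do rewrite !mxE; under [RHS]eq_bigr do rewrite !mxE.
  by rewrite -addnS !S; congr (_ == _)%:R; lia.
under eq_bigr do rewrite !mxE mulrA; under [RHS]eq_bigr do rewrite !mxE mulrA.
by rewrite -!mulr_suml !S addnC.
Qed.

Lemma Kmx_toepE (n q : nat) (w : 'rV[C]_q) (x : 'cV[C]_n) (y : 'cV[C]_q)
    (k j : 'I_n) :
  Kmx (@toepD n) (toepE w) (x, y) k j =
  \sum_(i < n) (val j == (k + i).+1)%:R * x i 0 + (j == k)%:R * wval w y.
Proof.
rewrite mxE /= mxE; congr (_ + _); rewrite mxE.
  by apply: eq_bigr => i _; rewrite mxE.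
rewrite /wval mxE mulr_sumr; apply: eq_bigr => z _.
by rewrite mxE mulrA.
Qed.

Lemma isotypic_single (q : nat) (w : 'rV[C]_q) (b : 'cV[C]_q) (n : nat) :
  wval w b != 0 -> isotypic w [:: n.+1].
Proof.
move=> wb; exists n.+1, (@toepD n.+1), (toepE w).
split; [by rewrite /= addn0 | exact: commuting_toep |].
have Kle (x : 'cV[C]_n.+1) (y : 'cV[C]_q) (k j : 'I_n.+1) : (j <= k)%N ->
    Kmx (@toepD n.+1) (toepE w) (x, y) k j = (j == k)%:R * wval w y.
  move=> jk; rewrite Kmx_toepE big1 ?add0r // => i _.
  by rewrite (_ : _ == _ = false) ?mul0r //=; lia.
have KS (x : 'cV[C]_n.+1) (y : 'cV[C]_q) (k j : 'I_n.+1) : val j = k.+1 ->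
    Kmx (@toepD n.+1) (toepE w) (x, y) k j = x 0 0.
  move=> jk; rewrite Kmx_toepE (_ : j == k = false) ?mul0r ?addr0; last first.
    by rewrite -val_eqE jk /=; lia.
  rewrite -(@sum_delta n.+1 0 (fun i => x i 0) 0) //.
  by apply: eq_bigr => i _; congr (_%:R * _); rewrite jk /=; lia.
(* The superdiagonal entry x_0 - mu a_0 of K_x - mu K_a, with the denominator of mu cleared. *)
pose f (v : pts n.+1 q) :=
  v.1.1 0 0 * wval w v.2.2 + (-1) * (wval w v.1.2 * v.2.1 0 0).
have pf : polyfun f.
  apply: polyfun_add; first apply: polyfun_mul.
  - by apply: polyfun_scalar => a u v; rewrite !mxE.
  - exact: wval_polyfun.
  apply: polyfun_mul; first exact: polyfun_const.
  apply: polyfun_mul.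
  - by apply: polyfun_scalar => a u v; rewrite -wval_scalar.
  - by apply: polyfun_scalar => a u v; rewrite !mxE.
have f0 : f ((delta_mx 0 0, 0), (0, b)) != 0.
  by rewrite /f /= !mxE eqxx mul1r mulr0 mulr0 addr0.
have g := @generic_neq0 _ _ ((0, 0), (0, b)) (@wval_polyfun n.+1 q w) wb.
apply: generic_imp (generic_and g (generic_neq0 pf f0)).
move=> [[x y] [a c]] /= [wc]; rewrite /f /= => fv; split=> //.
set mu := ev w y c; have muE : wval w y = mu * wval w c by rewrite /mu /ev mulfVK.
have xa : x 0 0 - mu * a 0 0 != 0.
  apply: contraNneq fv => /eqP; rewrite subr_eq0 => /eqP ->.
  by rewrite muE; apply/eqP; ring.
have [||||V [JV V0 Vi]] := @jordan_pencil_upper n (Kmx (@toepD n.+1) (toepE w) (x, y))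
          (Kmx (@toepD n.+1) (toepE w) (a, c)) mu.
- move=> i j ji; rewrite Kle; last exact: ltnW.
  by rewrite (_ : j == i = false) ?mul0r // -val_eqE /=; lia.
- by move=> i; rewrite Kle // eqxx mul1r.
- by move=> i j ji; rewrite !Kle // muE mulrCA.
- by move=> i j ji; rewrite !KS.
exists V; split=> // _ j j0; have -> : j = 0 by apply: val_inj.
(* The first column of [V] is a multiple of e_0, so only x_0 - mu a_0 contributes. *)
rewrite mxE (bigD1 0) //= big1 ?addr0 => [|i i0].
  by rewrite !mxE mulf_neq0.
by rewrite Vi ?mulr0.
Qed.

(** The new block is put first, so the eigenvector clause comes from the one-block summand. *)
Lemma isotypic_cat (q : nat) (w : 'rV[C]_q) (n : nat) (ns : seq nat) :
  isotypic w [:: n.+1] -> isotypic w ns -> isotypic w (n.+1 :: ns).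
Proof.
move=> [m1 [D1 [E1 [m1E c1 g1]]]] [m2 [D2 [E2 [m2E c2 g2]]]].
exists (m1 + m2)%N, (sumD D1 D2), (sumE E1 E2); split.
- by rewrite m1E m2E /= addn0.
- exact: commuting_sum.
apply: generic_imp (generic_and (generic_pts_u m2 g1) (generic_pts_d m1 g2)).
move=> [[x y] [a b]] /= [[wb [V1 [J1 V1n]]] [_ [V2 [J2 _]]]]; split=> //.
set mu := ev w y b in J1 J2 V1n *.
exists (block_mx V1 0 0 V2); split.
  rewrite !Kmx_sum -[Jm _ _]/(Jm (m1 + m2) ([seq (mu, k) | k <- [:: n.+1]] ++
                                           [seq (mu, k) | k <- ns])).
  rewrite (@Jm_cat m1); last by rewrite m1E.
  exact: jordan_pencil_block.
move=> _ j j0; have m1_gt0 : (0 < m1)%N by rewrite m1E.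
have -> : j = lshift m2 (Ordinal m1_gt0) by apply: val_inj.
rewrite -[x]vsubmxK -[a]vsubmxK scale_col_mx opp_col_mx add_col_mx tr_col_mx.
rewrite mul_row_block !mulmx0 addr0 add0r row_mxEl.
exact: V1n.
Qed.

Lemma isotypic_all (q : nat) (w : 'rV[C]_q) (b : 'cV[C]_q) (ns : seq nat) :
  wval w b != 0 -> all (fun n => 0 < n)%N ns -> isotypic w ns.
Proof.
move=> wb; elim: ns => [|[//|n] ns IH] /=; first by move=> _; apply: isotypic_nil wb.
by move=> /IH; apply: isotypic_cat; apply: isotypic_single wb.
Qed.

Definition lev (m q : nat) (l : 'rV[C]_m * 'rV[C]_q) (z : 'cV[C]_m * 'cV[C]_q) : C :=
  wval l.1 z.1 + wval l.2 z.2.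

Lemma lev_scalar (m q : nat) (l : 'rV[C]_m * 'rV[C]_q) : scalar (lev l).
Proof. by move=> a u v; rewrite /lev !wval_scalar mulrDr addrACA. Qed.

Lemma lev_central (m q : nat) (w : 'rV[C]_q) (z : 'cV[C]_m * 'cV[C]_q) :
  lev (0, w) z = wval w z.2.
Proof. by rewrite /lev /wval mul0mx [X in X + _]mxE add0r. Qed.

(* The eigenvalue of a tuple is l(x) / l(a) for a linear form l, which is either
   carried by the non-central coordinates or a prescribed central form. *)
Definition tagged (m q : nat) (tag : option 'rV[C]_q) (l : 'rV[C]_m * 'rV[C]_q) :
    Prop :=
  match tag with
  | Some w => l = (0, w)
  | None => l.1 != 0 /\ l.2 = 0
  end.

Definition tuple_model (q : nat) (tag : option 'rV[C]_q) (t : seq nat) : Prop :=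
  exists (m : nat) (D : 'I_m -> 'M[C]_m) (E : 'I_m -> 'M[C]_(m, q))
         (l : 'rV[C]_m * 'rV[C]_q),
  [/\ m = sumn t, commuting D E, tagged tag l &
  generic (fun v : pts m q =>
    lev l v.2 != 0 /\
    exists V, jordan_pencil (Kmx D E v.1) (Kmx D E v.2)
                (Jm m [seq (lev l v.1 / lev l v.2, n) | n <- t]) V)].

Lemma tuple_model_central (q : nat) (w : 'rV[C]_q) (t : seq nat) :
  isotypic w t -> tuple_model (Some w) t.
Proof.
move=> [m [D [E [mE cDE g]]]]; exists m, D, E, (0, w); split=> //.
apply: generic_imp g => v [wb [V [JV _]]]; rewrite !lev_central.
by split=> //; exists V.
Qed.

(** The former central vector becomes basis vector 0 of the enlarged M; the extra row, acting as the
    identity, commutes with all others. *)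
Definition growD (m : nat) (D : 'I_m -> 'M[C]_m) (E : 'I_m -> 'M[C]_(m, 1))
    (i : 'I_(1 + m)) : 'M[C]_(1 + m) :=
  match split i with
  | inl _ => 1%:M
  | inr k => block_mx 0 0 (E k) (D k)
  end.

Lemma commuting_grow (m q : nat) (D : 'I_m -> 'M[C]_m) (E : 'I_m -> 'M[C]_(m, 1)) :
  commuting D E -> commuting (growD D E) (fun _ => 0 : 'M[C]_(1 + m, q)).
Proof.
move=> cDE i j; split; last by rewrite !mulmx0.
rewrite /growD; case: (split i) => i'; case: (split j) => j';
  rewrite ?mul1mx ?mulmx1 //.
rewrite !mulmx_block !mulmx0 !mul0mx !add0r.
by have [-> ->] := cDE i' j'.
Qed.

(** The corner entry is the former central coordinate, so the border has the eigenvalue already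
    present in the pencil. *)
Lemma Kmx_grow (m q : nat) (D : 'I_m -> 'M[C]_m) (E : 'I_m -> 'M[C]_(m, 1))
    (x : 'cV[C]_(1 + m)) (y : 'cV[C]_q) :
  Kmx (growD D E) (fun _ => 0) (x, y) =
  block_mx (usubmx x 0 0)%:M (dsubmx x)^T 0 (Kmx D E (dsubmx x, usubmx x)).
Proof.
apply/matrixP => i j; rewrite [LHS]mxE /= mul0mx addr0.
rewrite -{1}[x]vsubmxK /growD -(splitK i) unsplitK.
case: (split i) => i' /=.
  rewrite mul1mx -(splitK j); case: (split j) => j' /=.
    by rewrite col_mxEu block_mxEul !ord1 [RHS]mxE eqxx mulr1n.
  by rewrite col_mxEd block_mxEur !ord1 [RHS]mxE.
rewrite mul_block_col !mul0mx addr0 -(splitK j); case: (split j) => j' /=.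
  by rewrite col_mxEu block_mxEdl !mxE.
by rewrite col_mxEd block_mxEdr [RHS]mxE /= addrC.
Qed.

Lemma generic_grow (m q : nat) (Q : pts m 1 -> Prop) :
  generic Q -> generic (fun v : pts (1 + m) q =>
    Q ((dsubmx v.1.1, usubmx v.1.1), (dsubmx v.2.1, usubmx v.2.1))).
Proof.
apply: (@generic_comp _ _ _
  (fun v => ((col_mx v.1.2 v.1.1, 0), (col_mx v.2.2 v.2.1, 0)))).
  by move=> a u v; rewrite /= !linearP.
by move=> [[x y] [a b]]; rewrite /= !col_mxKu !col_mxKd.
Qed.

Lemma tuple_model_grow (q n : nat) (ns : seq nat) :
  all (fun k => k <= n)%N ns -> all (fun k => 0 < k)%N ns ->
  @tuple_model q None (n.+1 :: ns).
Proof.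
case: n => [|n] nsn ns0.
  (* For the tuple with the single entry 1 there is no chain to prolong; one row acting as the
     identity on a line realises it. *)
  have -> : ns = [::].
    by case: ns nsn ns0 => // k ns /= /andP [k0 _] /andP [k1 _]; lia.
  exists 1%N, (fun _ => 1%:M), (fun _ => 0), (1%:M, 0).
  split; [by [] | by move=> i j; rewrite !mulmx0 | |].
    split; last by [].
    apply/eqP => /matrixP /(_ 0 0); rewrite !mxE eqxx => /eqP.
    by rewrite oner_eq0.
  have pf : polyfun (fun v : pts 1 q => lev (1%:M, 0) v.2).
    by apply: polyfun_scalar => a u v; rewrite -lev_scalar.
  have l0 : lev (1%:M, 0) (((0, 0), (1%:M, 0)) : pts 1 q).2 != 0.
    by rewrite /lev /wval /= mulmx1 mul0mx !mxE eqxx addr0 oner_eq0.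
  apply: generic_imp (generic_neq0 pf l0) => -[[x y] [a b]] /= la; split=> //.
  have lE (z : 'cV[C]_1) (y' : 'cV[C]_q) : lev (1%:M, 0) (z, y') = z 0 0.
    by rewrite /lev /wval /= mul1mx mul0mx [X in _ + X]mxE addr0.
  have KE (z : 'cV[C]_1) (y' : 'cV[C]_q) i j :
      Kmx (fun _ => 1%:M) (fun _ => 0) (z, y') i j = z 0 0.
    by rewrite mxE /= mul1mx mul0mx addr0 !ord1.
  rewrite lE in la.
  have [||||V [JV _ _]] := @jordan_pencil_upper 0 (Kmx (fun _ => 1%:M) (fun _ => 0) (x, y))
     (Kmx (fun _ => 1%:M) (fun _ => 0) (a, b)) (x 0 0 / a 0 0).
  - by move=> i j; rewrite !ord1.
  - by move=> i; rewrite KE.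
  - by move=> i j _; rewrite !KE mulfVK.
  - by move=> i j; rewrite !ord1.
  by exists V; rewrite /= !lE.
have w1 : wval 1%:M (1%:M : 'cV[C]_1) != 0.
  by rewrite /wval mulmx1 mxE eqxx oner_eq0.
(* Start from the tuple with its first entry lowered by one, over a one-dimensional centre. *)
have [m [D [E [mE cDE g]]]] : isotypic (1%:M : 'rV[C]_1) (n.+1 :: ns).
  by apply: isotypic_all w1 _; rewrite /= ns0.
rewrite /= in mE; subst m.
exists (1 + (n.+1 + sumn ns))%N, (growD D E), (fun _ => 0), (row_mx 1%:M 0, 0).
split; [by rewrite /= add1n | exact: commuting_grow | |].
  split=> //=; apply/eqP => /(congr1 (fun u : 'rV_(1 + (n.+1 + sumn ns)) => u 0 (lshift _ 0))).
  by rewrite row_mxEl !mxE eqxx => /eqP; rewrite oner_eq0.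
apply: generic_imp (generic_grow q g) => -[[x y] [a b]] /=.
have lE (z : 'cV[C]_(1 + (n.+1 + sumn ns))) (y' : 'cV[C]_q) :
    lev (row_mx 1%:M 0, 0) (z, y') = usubmx z 0 0.
  rewrite /lev /wval /= mul0mx [X in _ + X]mxE addr0 -{1}[z]vsubmxK.
  by rewrite mul_row_col mul1mx mul0mx addr0.
have evE (z z' : 'cV[C]_1) : ev 1%:M z z' = z 0 0 / z' 0 0.
  by rewrite /ev /wval !mul1mx.
rewrite /wval mul1mx evE !lE => -[a0 [V [JV V0]]]; split=> //.
rewrite !Kmx_grow; apply: jordan_pencil_grow => //.
- by rewrite mulrC mulfVK.
- exact: JV.
(* The eigenvector clause of [isotypic] is the nonvanishing needed to prolong the chain. *)
- by have := V0 isT 0 erefl; rewrite linearB linearZ.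
Qed.

(** * Tuples with pairwise distinct eigenvalues *)

Definition flat (mus : seq C) (ts : seq (seq nat)) : seq (C * nat) :=
  flatten [seq [seq (p.1, n) | n <- p.2] | p <- zip mus ts].

Lemma jsize_flat (mus : seq C) (ts : seq (seq nat)) :
  size mus = size ts -> jsize (flat mus ts) = sumn (map sumn ts).
Proof.
rewrite /flat; elim: mus ts => [|mu mus IH] [|t ts] //= [/IH E].
rewrite map_cat sumn_cat E -map_comp; congr (sumn _ + _)%N.
by rewrite -[RHS]map_id; apply: eq_map.
Qed.

Definition model (q : nat) (tags : seq (option 'rV[C]_q)) (ts : seq (seq nat)) :
    Prop :=
  exists (m : nat) (D : 'I_m -> 'M[C]_m) (E : 'I_m -> 'M[C]_(m, q))
         (ls : seq ('rV[C]_m * 'rV[C]_q)),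
  [/\ m = sumn (map sumn ts) /\ size ls = size ts, commuting D E,
      forall l, l \in ls -> exists2 tag, tag \in tags & tagged tag l &
  generic (fun v : pts m q =>
    let mus := [seq lev l v.1 / lev l v.2 | l <- ls] in
    [/\ forall l, l \in ls -> lev l v.2 != 0, uniq mus &
     exists V, jordan_pencil (Kmx D E v.1) (Kmx D E v.2) (Jm m (flat mus ts)) V])].

Lemma model_nil (q : nat) : @model q [::] [::].
Proof.
exists 0%N, (fun _ => 0), (fun _ => 0), [::]; split; [by [] | by move=> [] | by [] |].
apply: generic_true => v; split=> //; exists 1%:M.
split; rewrite ?unitmx1 //; last by rewrite [LHS]thinmx0 [RHS]thinmx0.
by rewrite unitmxE det_mx00 unitr1.
Qed.

(** Forms with these tags in two different summands are then linearly independent, so their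
    eigenvalues differ generically. Two non-central forms always are, as they involve disjoint
    coordinates. *)
Definition separated (q : nat) (tag tag' : option 'rV[C]_q) : Prop :=
  match tag, tag' with
  | Some w, Some w' =>
      exists y b, wval w y * wval w' b - wval w b * wval w' y != 0
  | Some w, None | None, Some w => exists b, wval w b != 0
  | None, None => True
  end.

Lemma wval_neq0 (m : nat) (u : 'rV[C]_m) : u != 0 -> exists x, wval u x != 0.
Proof.
case/rV0Pn => i ui; exists (delta_mx i 0).
by rewrite /wval -colE mxE.
Qed.

Lemma separated_forms (m1 m2 q : nat) (tag tag' : option 'rV[C]_q)
    (l1 : 'rV[C]_m1 * 'rV[C]_q) (l2 : 'rV[C]_m2 * 'rV[C]_q) :
  separated tag tag' -> tagged tag l1 -> tagged tag' l2 ->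
  exists v : pts (m1 + m2) q,
    lev l1 (pts_u v).1 * lev l2 (pts_d v).2
    + (-1) * (lev l1 (pts_u v).2 * lev l2 (pts_d v).1) != 0.
Proof.
have w0 m (u : 'rV[C]_m) : wval u 0 = 0 by rewrite /wval mulmx0 mxE.
have ww m (x : 'cV[C]_m) : wval 0 x = 0 by rewrite /wval mul0mx mxE.
case: tag => [w|]; case: tag' => [w'|] /=; rewrite /lev /pts_u /pts_d.
- move=> [y [b yb]] -> ->; exists ((0, y), (0, b)) => /=.
  by rewrite !ww !add0r mulN1r.
- move=> [b wb] -> [u0 ->]; have [a ua] := wval_neq0 u0.
  exists ((0, b), (col_mx 0 a, 0)) => /=.
  by rewrite !ww col_mxKd !w0 !add0r addr0 mul0r mulr0 addr0 mulf_neq0.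
- move=> [b wb] [u0 ->] ->; have [x ux] := wval_neq0 u0.
  exists ((col_mx x 0, 0), (0, b)) => /=.
  by rewrite !ww col_mxKu !linear0 !w0 !addr0 !add0r mul0r mulr0 addr0 mulf_neq0.
- move=> _ [u0 ->] [u0' ->]; have [x ux] := wval_neq0 u0.
  have [a ua] := wval_neq0 u0'; exists ((col_mx x 0, 0), (col_mx 0 a, 0)) => /=.
  by rewrite !col_mxKu !col_mxKd !w0 !addr0 mulr0 mulr0 addr0 mulf_neq0.
Qed.

Lemma model_cons (q : nat) (tag : option 'rV[C]_q) (tags : seq (option 'rV[C]_q))
    (t : seq nat) (ts : seq (seq nat)) :
  tuple_model tag t -> model tags ts ->
  (forall tag', tag' \in tags -> separated tag tag') ->
  model (tag :: tags) (t :: ts).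
Proof.
move=> [m1 [D1 [E1 [l1 [m1E c1 tl1 g1]]]]].
move=> [m2 [D2 [E2 [ls [[m2E sE] c2 tls g2]]]]] sep.
pose inj2 (l : 'rV[C]_m2 * 'rV[C]_q) : 'rV[C]_(m1 + m2) * 'rV[C]_q :=
  (row_mx 0 l.1, l.2).
pose l1' : 'rV[C]_(m1 + m2) * 'rV[C]_q := (row_mx l1.1 0, l1.2).
have lev1 (z : 'cV[C]_(m1 + m2) * 'cV[C]_q) : lev l1' z = lev l1 (usubmx z.1, z.2).
  rewrite /lev /wval -{1}[z.1]vsubmxK mul_row_col mul0mx addr0.
  by [].
have lev2 l (z : 'cV[C]_(m1 + m2) * 'cV[C]_q) : lev (inj2 l) z = lev l (dsubmx z.1, z.2).
  by rewrite /lev /wval -{1}[z.1]vsubmxK mul_row_col mul0mx add0r.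
exists (m1 + m2)%N, (sumD D1 D2), (sumE E1 E2), (l1' :: map inj2 ls); split.
- by rewrite /= size_map sE -m1E -m2E.
- exact: commuting_sum.
- move=> l; rewrite inE => /predU1P [->|/mapP [l' l'ls ->]].
    exists tag; rewrite ?mem_head //; rewrite /tagged /l1'.
    case: (tag) tl1 => [w ->|[u0 ->]] /=; first by rewrite row_mx0.
    split=> //; apply: contraNneq u0 => /(congr1 lsubmx).
    by rewrite row_mxKl linear0 => ->.
  have [tag' tag's tl'] := tls l' l'ls; exists tag'; first by rewrite inE tag's orbT.
  rewrite /tagged /inj2; case: (tag') tl' => [w ->|[u0 ->]] /=.
    by rewrite row_mx0.
  split=> //; apply: contraNneq u0 => /(congr1 rsubmx).
  by rewrite row_mxKr linear0 => ->.
(* The new eigenvalue differs from each of the others, with denominators cleared. *)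
have gs : generic (fun v : pts (m1 + m2) q => forall l, l \in ls ->
    lev l1 (pts_u v).1 * lev l (pts_d v).2
    + (-1) * (lev l1 (pts_u v).2 * lev l (pts_d v).1) != 0).
  apply: generic_all => l lls; have [tag' tag's tl] := tls l lls.
  have [v0 v0P] := separated_forms (sep tag' tag's) tl1 tl.
  have pu z : z = fst \/ z = snd -> polyfun (fun v => lev l1 (z (pts_u v))).
    by move=> zE; apply: polyfun_scalar => a u v; rewrite -lev_scalar;
      case: zE => ->; rewrite /= !linearP.
  have pd z : z = fst \/ z = snd -> polyfun (fun v => lev l (z (pts_d v))).
    by move=> zE; apply: polyfun_scalar => a u v; rewrite -lev_scalar;
      case: zE => ->; rewrite /= !linearP.
  pose f (v : pts (m1 + m2) q) := lev l1 (pts_u v).1 * lev l (pts_d v).2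
    + (-1) * (lev l1 (pts_u v).2 * lev l (pts_d v).1).
  have pf : polyfun f.
    apply: polyfun_add; last apply: polyfun_mul (polyfun_const _ _) _;
      by apply: polyfun_mul; [apply: pu; auto | apply: pd; auto].
  exact: (generic_neq0 pf v0P).
apply: generic_imp (generic_and gs (generic_and (generic_pts_u m2 g1)
                                                (generic_pts_d m1 g2))).
move=> [[x y] [a b]]; rewrite /pts_u /pts_d /= => -[cross [[l1a [V1 J1]]]].
move=> [lsa us [V2 J2]].
have musE : [seq lev l (x, y) / lev l (a, b) | l <- map inj2 ls] =
    [seq lev l (dsubmx x, y) / lev l (dsubmx a, b) | l <- ls].
  by rewrite -map_comp; apply: eq_map => l; rewrite /= !lev2.
rewrite musE !lev1 /=; split.
- move=> l; rewrite inE => /predU1P [->|/mapP [l' l'ls ->]]; first by rewrite lev1.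
  by rewrite lev2; apply: lsa.
- rewrite us andbT; apply/mapP => -[l lls /eqP].
  rewrite eqr_div ?lsa // => /eqP E; have /negP := cross l lls; case.
  by rewrite E mulN1r [X in X - _]mulrC subrr.
exists (block_mx V1 0 0 V2); rewrite !Kmx_sum [flat _ _]/= -/(flat _ _).
rewrite (@Jm_cat m1); first exact: jordan_pencil_block.
rewrite -map_comp -[RHS]/(m1 : nat) [RHS]m1E; congr sumn.
by rewrite -[RHS]map_id; apply: eq_map.
Qed.

(** * From models to Lie algebras *)

Lemma model_JK_invariants (q : nat) (tags : seq (option 'rV[C]_q))
    (ts : seq (seq nat)) :
  model tags ts ->
  exists (d : nat) (c : 'I_d -> 'I_d -> 'I_d -> C),
    lie_structure c /\ lie_JK_invariants c (nseq q 1%N) ts.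
Proof.
move=> [m [D [E [ls [[mE sE] cDE _ g]]]]].
exists (m + (m + q))%N, (row_lie D E); split; first exact: row_lie_structure.
pose d := (m + (m + q))%N.
pose h (v : 'cV[C]_(d + d)) : pts m q :=
  (dual_coords (fun j => v (lshift d j) 0), dual_coords (fun j => v (rshift d j) 0)).
have hL : linear h.
  move=> a u v; rewrite /h /dual_coords.
  by congr ((_, _), (_, _)); apply/matrixP => i j; rewrite !mxE.
pose s (p : pts m q) : 'cV[C]_(d + d) :=
  col_mx (col_mx 0 (col_mx p.1.1 p.1.2)) (col_mx 0 (col_mx p.2.1 p.2.2)).
have sK : cancel s h.
  move=> [[x y] [a b]]; rewrite /h /s /dual_coords /=.
  by congr ((_, _), (_, _)); apply/matrixP => i j;
    rewrite mxE ?col_mxEu ?col_mxEd ?col_mxEu ?col_mxEd ?col_mxEu ?col_mxEd ord1.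
have [U [Uo U0 UQ]] := generic_zariski_open (generic_comp hL sK g).
exists U; split=> //; split=> // v /UQ.
have -> : h (\col_i v i) =
    (dual_coords (fun j => v (lshift d j)), dual_coords (fun j => v (rshift d j))).
  by congr ((_, _), (_, _)); apply/matrixP => i j; rewrite !mxE.
set z := dual_coords _; set z' := dual_coords _.
rewrite /= => -[_ us [V [uA uV JV]]].
set mus := map _ ls in us JV.
have smus : size mus = size ts by rewrite size_map.
(* The eigenvalue infinity does not occur, since K_a is invertible. *)
exists (map Some mus); split; first by rewrite size_map.
split; first by rewrite map_inj_uniq // => ? ? [].
rewrite !coadj_form_row_lie.
have -> : [seq Kron k | k <- nseq q 1%N] ++ flatten
      [seq [seq Jord p.1 n | n <- p.2] | p <- zip (map Some mus) ts]
    = nseq q (Kron 1) ++ map jord (flat mus ts).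
  rewrite map_nseq; congr (_ ++ _); rewrite /flat.
  elim: (mus) (ts) => [|mu ms IH] [|t l] //=.
  by rewrite map_cat -map_comp IH.
by apply: jk_normal_form_skewmx uA uV JV; rewrite jsize_flat.
Qed.

Theorem theorem14 :
  (forall tuples : seq (seq nat),
     all jordan_tuple tuples ->
     (count multiple_maxima tuples <= 1)%N ->
     exists (d : nat) (c : 'I_d -> 'I_d -> 'I_d -> C),
       lie_structure c /\ lie_JK_invariants c [:: 1%N] tuples) /\
  (forall q : nat, (2 <= q)%N ->
   forall tuples : seq (seq nat),
     all jordan_tuple tuples ->
     exists (d : nat) (c : 'I_d -> 'I_d -> 'I_d -> C),
       lie_structure c /\ lie_JK_invariants c (nseq q 1%N) tuples).
Proof.
split=> [ts jt cm | [//|[//|q]] _ ts jt].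
  (* The only central direction is reserved for the tuple with multiple maxima; the other tuples get
     non-central eigenvalues. *)
  pose tag t := if multiple_maxima t then Some (1%:M : 'rV[C]_1) else None.
  apply: (@model_JK_invariants 1 [seq tag t | t <- ts]).
  have w1 : wval (1%:M : 'rV[C]_1) 1%:M != 0.
    by rewrite /wval mulmx1 mxE eqxx oner_eq0.
  elim: ts jt cm => [|t ts IH] /=; first by move=> _ _; apply: model_nil.
  move=> /andP [tj jt] cm; apply: model_cons.
  - rewrite /tag; move: tj; rewrite /jordan_tuple => /and3P [st tg t0].
    case: ifPn => mt.
      by apply: tuple_model_central; apply: isotypic_all w1 t0.
    case: t st tg t0 mt {cm} => [//|[//|n] ns] _ /= tg ns0 mt.
    apply: tuple_model_grow => //.
    case: ns tg ns0 mt => [//|k ns] /= /andP [kn ks] _.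
    (* Without multiple maxima the second entry is strictly below n + 1, hence at most n. *)
    rewrite /multiple_maxima /= => nk; have {nk kn}kn : (k <= n)%N by lia.
    rewrite kn /=; apply/allP => l lns.
    apply: leq_trans kn; move: ks; rewrite (path_sortedE (rev_trans leq_trans)).
    by case/andP => /allP /(_ l lns).
  - by apply: IH => //; lia.
  move=> tag' /mapP [t' t'ts ->]; rewrite /tag.
  case: ifPn => mt; case: ifPn => mt' //; try by exists 1%:M.
  (* Two central tags would require two tuples with multiple maxima. *)
  suff : (0 < count multiple_maxima ts)%N by move: cm; rewrite mt; lia.
  by rewrite -has_count; apply/hasP; exists t'.
(* The form [w i] takes the values i at [y] and 1 at [b], so the determinant separating [w i] from
   [w j] is i - j. *)
pose w i : 'rV[C]_q.+2 := i%:R *: delta_mx 0 0 + delta_mx 0 (lift ord0 ord0).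
pose y : 'cV[C]_q.+2 := delta_mx 0 0; pose b : 'cV[C]_q.+2 := delta_mx (lift ord0 ord0) 0.
have wy i : wval (w i) y = i%:R by rewrite /wval -colE !mxE /= mulr1 addr0.
have wb i : wval (w i) b = 1 by rewrite /wval -colE !mxE /= mulr0 add0r.
(* The offset [i] is generalised so that all later indices exceed the first one in the induction. *)
suff M i : model [seq Some (w j) | j <- iota i (size ts)] ts.
  exact: model_JK_invariants (M 0%N).
elim: ts i jt => [|t ts IH] i /=; first by move=> _; apply: model_nil.
move=> /andP [/and3P [_ _ t0] jt]; apply: model_cons.
- apply: tuple_model_central; apply: (@isotypic_all _ _ b) => //.
  by rewrite wb oner_eq0.
- exact: IH.
move=> tag /mapP [j jts ->]; exists y, b; rewrite !wy !wb mulr1 mul1r.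
move: jts; rewrite mem_iota => /andP [ij _].
by rewrite -opprB oppr_eq0 -natrB ?C_natr_eq0; lia.
Qed.
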